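(* Let $(M,\xi,\lambda,g)$ be a compact and connected $n$-dimensional almost Ricci soliton ($n>2$) whose potential vector field $\xi$ is closed (in particular, gradient) and affine conformal Killing, i.e. $$\mathcal L_{\xi}\nabla=d\rho\otimes I+I\otimes d\rho-g\otimes\nabla\rho$$ for a smooth function $\rho$ on $M$. If $\operatorname{trace}(H)=0$, then $\xi$ is a conformal Killing vector field and the manifold is Einstein.
   Context: $(M,g)$ is a Riemannian manifold with Levi-Civita connection $\nabla$; $\nabla\rho$ is the gradient of $\rho$. The displayed condition on $\xi$ means $(\mathcal L_{\xi}\nabla)(X,Y)=X(\rho)Y+Y(\rho)X-g(X,Y)\nabla\rho$ for all vector fields $X,Y$; it is equivalent to $\mathcal L_{\xi}g=2\rho g+K$ with $K$ a symmetric $(0,2)$-tensor field satisfying $\nabla K=0$. $H$ is the $(1,1)$-tensor field defined by $g(HX,Y)=K(X,Y)$, where $K=\mathcal L_\xi g-2\rho g$. $(M,\xi,\lambda,g)$ is an almost Ricci soliton if $\lambda$ is a smooth function on $M$ and $\frac12\mathcal L_{\xi}g+\operatorname{Ric}=\lambda g$. A vector field is closed if its $g$-dual $1$-form is closed. A vector field $\xi$ is conformal Killing if $\mathcal L_\xi g=2\sigma g$ for some smooth function $\sigma$ on $M$. $(M,g)$ is Einstein if $\operatorname{Ric}=\frac{r}{n}g$, with $r$ the scalar curvature. *)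

(* Defs.v *)
From mathcomp Require Import all_boot all_order all_algebra.
From mathcomp Require Import all_classical all_reals all_analysis.
Import Order.TTheory GRing.Theory Num.Theory.
Import numFieldNormedType.Exports.

Set Implicit Arguments.
Unset Strict Implicit.
Unset Printing Implicit Defensive.

Local Open Scope classical_set_scope.
Local Open Scope ring_scope.

(** * Smooth manifolds *)

(** [k]-fold (Frechet) differentiability on an open set [W]; holding for all [k],
    it is smoothness. *)
Fixpoint diff_upto (R : realType) (V V' : normedModType R) (k : nat)
    (W : set V) (h : V -> V') : Prop :=
  match k with
  | 0 => True
  | k'.+1 => (forall x, W x -> differentiable h x) /\
             (forall v, diff_upto k' W (fun x => 'D_v h x))
  end.

Definition Cinfty_on (R : realType) (V V' : normedModType R) (W : set V)
    (h : V -> V') : Prop := forall k, diff_upto k W h.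

(** A smooth [n]-manifold (without boundary), given by a smooth atlas.
    [chart_inv i] inverts [chart_map i] on the image of the chart domain and is
    arbitrary elsewhere.  [chart_at p] is a preferred chart around [p]; it serves
    only to represent tangent vectors (see below). *)
Record smooth_manifold (R : realType) (n : nat) (M : topologicalType) :=
  SmoothManifold {
    chart_index : Type;
    chart_dom : chart_index -> set M;
    chart_map : chart_index -> M -> 'rV[R]_n;
    chart_inv : chart_index -> 'rV[R]_n -> M;
    chart_at : M -> chart_index;
    manifold_hausdorff : hausdorff_space M;
    manifold_second_countable : @second_countable M;
    chart_dom_open : forall i, open (chart_dom i);
    chart_image_open : forall i, open (chart_map i @` chart_dom i);
    chart_mapK : forall i p, chart_dom i p -> chart_inv i (chart_map i p) = p;
    chart_map_continuous : forall i p, chart_dom i p ->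
      {for p, continuous (chart_map i)};
    chart_inv_continuous : forall i x, (chart_map i @` chart_dom i) x ->
      {for x, continuous (chart_inv i)};
    chart_atP : forall p, chart_dom (chart_at p) p;
    transition_smooth : forall i j,
      Cinfty_on (chart_map i @` (chart_dom i `&` chart_dom j))
        (chart_map j \o chart_inv i)
  }.

Arguments chart_dom {R n M}.
Arguments chart_map {R n M}.
Arguments chart_inv {R n M}.

Section Manifold.
Context (R : realType) (n : nat) (M : topologicalType).
Context (A : smooth_manifold R n M).

Definition smooth_on (U : set M) (f : M -> R) : Prop :=
  forall i, Cinfty_on (chart_map A i @` (U `&` chart_dom A i))
    (f \o chart_inv A i).

Definition smooth (f : M -> R) : Prop := smooth_on setT f.

(** The tangent space at [p] is ['rV[R]_n]: a tangent vector is given by its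
    components in the chart [chart_at A p].  [tdiff F p v] is the differential
    at [p] of a map [F] into a normed space, applied to the tangent vector
    [v]. *)
Definition tdiff (V : normedModType R) (F : M -> V) (p : M)
    (v : 'rV[R]_n) : V :=
  'd (F \o chart_inv A (chart_at A p)) (chart_map A (chart_at A p) p) v.

Definition vfield := M -> 'rV[R]_n.

(** The derivative [X(F)] of [F] along the vector field [X]. *)
Definition vder (V : normedModType R) (X : vfield) (F : M -> V) : M -> V :=
  fun p => tdiff F p (X p).

(** [vder X (chart_map A i)] is the component vector of [X] in the chart [i]. *)
Definition smooth_vfield_on (U : set M) (X : vfield) : Prop :=
  forall i k, smooth_on (U `&` chart_dom A i)
    (fun p => vder X (chart_map A i) p 0 k).

Definition smooth_vfield (X : vfield) : Prop := smooth_vfield_on setT X.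

(** The Lie bracket at [p]: the [k]-th component is [X(Y(x^k)) - Y(X(x^k))],
    with [x] the coordinates of [chart_at A p]. *)
Definition bracket (X Y : vfield) : vfield := fun p =>
  vder X (vder Y (chart_map A (chart_at A p))) p
  - vder Y (vder X (chart_map A (chart_at A p))) p.

(** The coordinate vector field [d/dx^k] of the chart [i] (on its domain). *)
Definition coord_vfield (i : chart_index A) (k : 'I_n) : vfield := fun p =>
  'd (chart_map A (chart_at A p) \o chart_inv A i) (chart_map A i p)
    (delta_mx 0 k).

(** * Riemannian geometry *)

Definition inner (g : M -> 'M[R]_n) (X Y : vfield) : M -> R :=
  fun p => (X p *m g p *m (Y p)^T) 0 0.

Record riemannian_metric (g : M -> 'M[R]_n) : Prop := RiemannianMetric {
  metric_sym : forall p, (g p)^T = g p;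
  metric_pos : forall p (v : 'rV[R]_n), v != 0 -> 0 < (v *m g p *m v^T) 0 0;
  metric_smooth : forall U X Y, open U -> smooth_vfield_on U X ->
    smooth_vfield_on U Y -> smooth_on U (inner g X Y)
}.

(** Identities between tensor fields, and the axioms of connections, are tested
    on smooth vector fields over arbitrary open subsets; the global vector
    fields are the case [U = setT]. *)
Definition for_all_vfields2 (P : vfield -> vfield -> M -> Prop) : Prop :=
  forall (U : set M) (X Y : vfield), open U -> smooth_vfield_on U X ->
    smooth_vfield_on U Y -> forall p, U p -> P X Y p.

Definition for_all_vfields3 (P : vfield -> vfield -> vfield -> M -> Prop) :
    Prop :=
  forall (U : set M) (X Y Z : vfield), open U -> smooth_vfield_on U X ->
    smooth_vfield_on U Y -> smooth_vfield_on U Z ->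
    forall p, U p -> P X Y Z p.

(** [nabla X Y] is the covariant derivative of [Y] in the direction of [X]. *)
Record affine_connection (nabla : vfield -> vfield -> vfield) : Prop :=
  AffineConnection {
    connection_smooth : forall U X Y, open U -> smooth_vfield_on U X ->
      smooth_vfield_on U Y -> smooth_vfield_on U (nabla X Y);
    connection_linear : forall U f X Y Z, open U -> smooth_on U f ->
      smooth_vfield_on U X -> smooth_vfield_on U Y -> smooth_vfield_on U Z ->
      forall p, U p ->
      nabla (fun q => f q *: X q + Y q) Z p = f p *: nabla X Z p + nabla Y Z p;
    connection_additive : for_all_vfields3 (fun X Y Z p =>
      nabla X (fun q => Y q + Z q) p = nabla X Y p + nabla X Z p);
    connection_leibniz : forall U f X Y, open U -> smooth_on U f ->
      smooth_vfield_on U X -> smooth_vfield_on U Y -> forall p, U p ->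
      nabla X (fun q => f q *: Y q) p = vder X f p *: Y p + f p *: nabla X Y p
  }.

Record levi_civita (g : M -> 'M[R]_n) (nabla : vfield -> vfield -> vfield) :
    Prop := LeviCivita {
  levi_civita_connection : affine_connection nabla;
  levi_civita_torsion_free : for_all_vfields2 (fun X Y p =>
    nabla X Y p - nabla Y X p = bracket X Y p);
  levi_civita_metric : for_all_vfields3 (fun X Y Z p =>
    vder Z (inner g X Y) p
    = inner g (nabla Z X) Y p + inner g X (nabla Z Y) p)
}.

Definition is_gradient (g : M -> 'M[R]_n) (f : M -> R) (G : vfield) : Prop :=
  forall p (v : 'rV[R]_n), (G p *m g p *m v^T) 0 0 = tdiff f p v.

Definition lie_metric (g : M -> 'M[R]_n) (xi X Y : vfield) : M -> R := fun p =>
  vder xi (inner g X Y) p - inner g (bracket xi X) Y p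
  - inner g X (bracket xi Y) p.

Definition lie_connection (nabla : vfield -> vfield -> vfield)
    (xi X Y : vfield) : vfield := fun p =>
  bracket xi (nabla X Y) p - nabla (bracket xi X) Y p
  - nabla X (bracket xi Y) p.

Definition riemann (nabla : vfield -> vfield -> vfield) (X Y Z : vfield) :
    vfield := fun p =>
  nabla X (nabla Y Z) p - nabla Y (nabla X Z) p - nabla (bracket X Y) Z p.

(** [Ric(Y,Z)] is the trace of [X |-> R(X,Y)Z].  At [p] the coordinate vector
    fields of [chart_at A p] are the standard basis of the tangent space. *)
Definition ricci (nabla : vfield -> vfield -> vfield) (Y Z : vfield) :
    M -> R := fun p =>
  \tr (\matrix_(i < n)
         riemann nabla (coord_vfield (chart_at A p) i) Y Z p).

Definition scalar_curvature (g : M -> 'M[R]_n)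
    (nabla : vfield -> vfield -> vfield) : M -> R := fun p =>
  \tr (invmx (g p) *m
       \matrix_(i < n, j < n)
         ricci nabla (coord_vfield (chart_at A p) i)
                     (coord_vfield (chart_at A p) j) p).

Definition einstein (g : M -> 'M[R]_n)
    (nabla : vfield -> vfield -> vfield) : Prop :=
  for_all_vfields2 (fun X Y p =>
    ricci nabla X Y p = scalar_curvature g nabla p / n%:R * inner g X Y p).

Definition closed_vfield (g : M -> 'M[R]_n) (xi : vfield) : Prop :=
  for_all_vfields2 (fun X Y p =>
    vder X (inner g xi Y) p - vder Y (inner g xi X) p
    - inner g xi (bracket X Y) p = 0).

Definition conformal_killing (g : M -> 'M[R]_n) (xi : vfield) : Prop :=
  exists2 sigma : M -> R, smooth sigma &
    for_all_vfields2 (fun X Y p =>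
      lie_metric g xi X Y p = 2 * sigma p * inner g X Y p).

Definition affine_conformal_killing (g : M -> 'M[R]_n)
    (nabla : vfield -> vfield -> vfield) (xi : vfield) (rho : M -> R) : Prop :=
  exists2 grad_rho : vfield, is_gradient g rho grad_rho &
  for_all_vfields2 (fun X Y p =>
    lie_connection nabla xi X Y p
    = vder X rho p *: Y p + vder Y rho p *: X p
      - inner g X Y p *: grad_rho p).

Definition almost_ricci_soliton (g : M -> 'M[R]_n)
    (nabla : vfield -> vfield -> vfield) (xi : vfield) (lambda : M -> R) :
    Prop :=
  [/\ smooth_vfield xi, smooth lambda &
      for_all_vfields2 (fun X Y p =>
        2^-1 * lie_metric g xi X Y p + ricci nabla X Y p
        = lambda p * inner g X Y p)].

(** [H] is a field of endomorphisms (acting on row vectors from the right) with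
    [g(HX,Y) = K(X,Y)], where [K = L_xi g - 2 rho g]. *)
Definition is_H_tensor (g : M -> 'M[R]_n) (xi : vfield) (rho : M -> R)
    (H : M -> 'M[R]_n) : Prop :=
  for_all_vfields2 (fun X Y p =>
    inner g (fun q => X q *m H q) Y p
    = lie_metric g xi X Y p - 2 * rho p * inner g X Y p).

End Manifold.

(* Main.v *)
From HB Require Import structures.
Require Import Defs.
From mathcomp Require Import all_boot all_order all_algebra.
From mathcomp Require Import all_classical all_reals all_analysis.
From mathcomp Require Import ring lra.
Import Order.TTheory GRing.Theory Num.Theory.
Import numFieldNormedType.Exports.

Local Open Scope classical_set_scope.
Local Open Scope ring_scope.

Set Implicit Arguments.
Unset Strict Implicit.
Unset Printing Implicit Defensive.

(** The proof is pointwise, apart from one maximum argument; nothing is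
    integrated.

    As [xi] is closed, [nabla xi] is self-adjoint, and [L_xi g = 2 rho g + g(H ., .)]
    becomes [nabla_X xi = B X] with [B = rho + H/2] ([nabla_xi]). The affine conformal
    equation, rewritten through the torsion-free connection, is
    [R(xi,X)Y + (nabla_X H)(Y)/2 = Y(rho) X - g(X,Y) grad rho]; comparing
    self-adjoint and skew-adjoint parts gives [nabla H = 0] ([H_parallel]). Thus
    [R(X,Y) xi = X(rho) Y - Y(rho) X], and [R(X,Y)] commutes with [H]
    ([riemann_xi], [riemann_H]).

    The soliton equation makes the Ricci operator equal to [lambda - rho - H/2],
    which commutes with [H]. Computing [Ric(Y, H xi) = Ric(H Y, xi)] as traces of
    the two curvature formulas, with [tr H = 0], gives [d rho (H Y) = 0]
    ([drho_H_eq0]). Skewness of [R(X, H xi)] between [xi] and [H xi] then gives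
    [X(rho) |H xi|^2 = 0] ([drho_Hxi_eq0]). So [H xi = 0] wherever [d rho] does not
    vanish, and differentiating, [H B = 0] there; its trace is [tr(H^2) = 0]
    ([trace_H2_of_drho_neq0]).

    Let now [p] be a maximum of [|xi|^2] on the compact manifold. If [d rho]
    vanishes at [p], the Hessian of [|xi|^2] at [p] is [2 |B X|^2], which must be
    nonpositive; so [B = 0] at [p], and since [tr H = 0] also [H = 0]. In
    both cases [tr(H^2) = 0] at [p] ([trace_H2_at_max]). Since [H] is parallel,
    [tr(H^2)] is locally constant ([trace_H2_locally_constant]), hence zero on the
    connected manifold; as [H] is self-adjoint, [H = 0] ([H_eq0]). Therefore
    [L_xi g = 2 rho g] and [Ric = (lambda - rho) g], and tracing the latter
    identifies [lambda - rho] with [r / n]. *)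

(** * Linear algebra *)

Section MatrixIdentities.
Context (R : comNzRingType).

Lemma mx_entry n (B : 'M[R]_n) k l :
  ((delta_mx 0 k : 'rV[R]_n) *m B *m (delta_mx 0 l : 'rV[R]_n)^T) 0 0 = B k l.
Proof. by rewrite trmx_delta -rowE -colE !mxE. Qed.

Lemma trace_sqr_conj n (P Q N H : 'M[R]_n) :
  Q *m P = 1%:M -> P *m H = N *m P -> \tr (H *m H) = \tr (N *m N).
Proof.
move=> QP PH; have -> : H = Q *m (N *m P) by rewrite -PH mulmxA QP mul1mx.
rewrite -mulmxA mxtrace_mulC -!mulmxA (mulmxA P) (mulmx1C QP) mul1mx.
by rewrite mulmx1.
Qed.

Lemma trace_mul_commutator n (N B : 'M[R]_n) :
  \tr (N *m (B *m N - N *m B)) = 0.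
Proof.
by rewrite mulmxBr linearB /= [in X in X - _]mulmxA [in X in X - _]mxtrace_mulC subrr.
Qed.

End MatrixIdentities.

Section SelfAdjoint.
Context (R : rcfType).

Lemma trmx_block_sym m (S : 'M[R]_(1 + m)) : S^T = S -> dlsubmx S = (ursubmx S)^T.
Proof. by move=> sS; rewrite trmx_ursub sS. Qed.

Lemma congruence_mul k m (x : 'M[R]_(k, m)) (L S : 'M[R]_m) :
  (x *m L) *m S *m (x *m L)^T = x *m (L *m S *m L^T) *m x^T.
Proof. by rewrite trmx_mul !mulmxA. Qed.

(** Gram-Schmidt in matrix form, by induction on the dimension: the congruence
    [L] clears the first row and column of [S], and the remaining block, a Schur
    complement, is again positive definite. *)
Lemma posdef_orthonormal_basis n (S : 'M[R]_n) : S^T = S ->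
  (forall v : 'rV[R]_n, v != 0 -> 0 < (v *m S *m v^T) 0 0) ->
  exists E : 'M[R]_n, E *m S *m E^T = 1%:M.
Proof.
elim: n S => [|m IH] S sS pS; first by exists 0; apply/matrixP => -[].
pose S1 : 'M[R]_(1 + m) := S.
pose a := S1 0 0; pose b := ursubmx S1; pose D := drsubmx S1.
have a0 : 0 < a.
  pose e : 'rV[R]_m.+1 := delta_mx 0 0.
  have <- : (e *m S *m e^T) 0 0 = a by rewrite /e trmx_delta -rowE -colE !mxE.
  apply: pS; apply/eqP => /rowP/(_ 0); rewrite !mxE !eqxx /= => /eqP.
  by rewrite oner_eq0.
have SE : S1 = block_mx a%:M b b^T D.
  rewrite -[LHS]submxK trmx_block_sym //; congr block_mx.
  by apply/rowP => j; rewrite !ord1 !mxE mulr1n /a; congr (S1 _ _); apply/val_inj.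
pose L : 'M[R]_(1 + m) := block_mx 1%:M 0 (- a^-1 *: b^T) 1%:M.
pose S' := D - a^-1 *: (b^T *m b).
have LS : L *m S1 *m L^T = block_mx a%:M 0 0 S'.
  rewrite SE /L mulmx_block tr_block_mx mulmx_block.
  rewrite !mul1mx !mul0mx !addr0 !trmx1 !trmx0 !mulmx1 !mulmx0 !addr0.
  rewrite !linearZ /= trmxK -!scalemxAl mul_mx_scalar mul_scalar_mx !scalerA.
  rewrite !mulNr mulVf ?gt_eqF // !scaleN1r !addNr mul0mx scaler0 add0r.
  by rewrite addrC scaleNr.
have sS' : S'^T = S'.
  rewrite /S' linearB /= linearZ /= trmx_mul trmxK; congr (_ - _).
  by rewrite /D trmx_drsub sS.
have pS' (w : 'rV[R]_m) : w != 0 -> 0 < (w *m S' *m w^T) 0 0.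
  move=> w0; pose u : 'rV[R]_(1 + m) := row_mx 0 w *m L.
  (* [u] is nonzero because its last [m] entries are those of [w]. *)
  have -> : w *m S' *m w^T = u *m S1 *m u^T.
    rewrite /u congruence_mul LS mul_row_block !mulmx0 mul0mx !add0r tr_row_mx mul_row_col.
    by rewrite mul0mx add0r.
  apply: pS; apply: contra w0 => /eqP u0; apply/eqP.
  have := congr1 (@rsubmx _ 1 1 m) u0.
  by rewrite /u mul_row_block row_mxKr mul0mx add0r mulmx1 linear0.
have [E' EE'] := IH S' sS' pS'.
pose F : 'M[R]_(1 + m) := block_mx (Num.sqrt a)^-1%:M 0 0 E'.
suff FF : F *m (L *m S1 *m L^T) *m F^T = 1%:M.
  exists (F *m L : 'M[R]_(1 + m)); rewrite -[RHS]FF.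
  exact: (congruence_mul F L S1).
rewrite LS /F tr_block_mx !mulmx_block !trmx0 !mul0mx !mulmx0 !addr0 !add0r.
rewrite EE' tr_scalar_mx -!scalar_mxM.
have -> : (Num.sqrt a)^-1 * a * (Num.sqrt a)^-1 = 1.
  have s0 : Num.sqrt a != 0 by rewrite gt_eqF // sqrtr_gt0.
  by rewrite -{2}[a]sqr_sqrtr ?ltW // expr2; field.
by rewrite !mul0mx -scalar_mx_block.
Qed.

(** [H] is self-adjoint for the scalar product [S]; in an orthonormal basis it
    becomes a symmetric matrix [K], and [tr(H^2) = tr(K K^T)] is the sum of the
    squares of the entries of [K]. *)
Lemma self_adjoint_trace_sqr_eq0 n (S H : 'M[R]_n) : S^T = S ->
  (forall v : 'rV[R]_n, v != 0 -> 0 < (v *m S *m v^T) 0 0) ->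
  H *m S = S *m H^T -> \tr (H *m H) = 0 -> H = 0.
Proof.
move=> sS pS HS t0; have [E ES] := posdef_orthonormal_basis sS pS.
have [E' [E'_def EE']] : exists E', E' = S *m E^T /\ E *m E' = 1%:M.
  by exists (S *m E^T); rewrite mulmxA.
have E'E : E' *m E = 1%:M by exact: mulmx1C.
pose K := E *m H *m E'.
have sK : K^T = K.
  rewrite /K E'_def !trmx_mul trmxK sS mulmxA -[LHS]mulmxA -[E *m S *m _]mulmxA.
  by rewrite [S *m (H^T *m _)]mulmxA -HS !mulmxA.
have tK : \sum_i \sum_j K i j ^+ 2 = 0.
  have tKK : \tr (K *m K) = 0.
    rewrite /K -!mulmxA (mulmxA E' E) E'E mul1mx mxtrace_mulC -!mulmxA E'E mulmx1.
    exact: t0.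
  transitivity (\tr (K *m K^T)); last by rewrite sK.
  rewrite /mxtrace; apply: eq_bigr => i _; rewrite mxE.
  by apply: eq_bigr => j _; rewrite [K^T j i]mxE expr2.
have K0 : K = 0.
  apply/matrixP => i j; rewrite [RHS]mxE; apply/eqP; rewrite -sqrf_eq0.
  have h1 k : 0 <= \sum_l K k l ^+ 2 by apply: sumr_ge0 => l _; exact: sqr_ge0.
  have h2 : \sum_l K i l ^+ 2 = 0.
    by apply: (psumr_eq0P _ tK) => // k _; exact: h1.
  by apply/eqP; apply: (psumr_eq0P _ h2) => // l _; exact: sqr_ge0.
have -> : H = E' *m K *m E.
  by rewrite /K !mulmxA E'E mul1mx -mulmxA E'E mulmx1.
by rewrite K0 mulmx0 mul0mx.
Qed.

End SelfAdjoint.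

(** * Differential calculus in normed spaces *)

Section Line.
Context (R : realType) (V : normedModType R).

Lemma near_eq_is_diff (W : normedModType R) (f g : V -> W) (x : V) :
  (\near x, f x = g x) -> differentiable f x ->
  differentiable g x /\ 'd g x = 'd f x :> (V -> W).
Proof.
move=> fg df.
have fgx : f x = g x by exact: nbhs_singleton fg.
have [dc dE] := (diff_locallyP _ _).1 df.
have gE : g \o shift x = cst (g x) + 'd f x +o_ 0 id.
  apply/eqaddoP => e e0.
  have /eqaddoP/(_ _ e0) h := dE.
  have fg0 : \forall y \near 0, f (y + x) = g (y + x).
    move: fg; rewrite (near_shift 0 x) /=.
    by apply: filterS => y /=; rewrite subr0.
  apply: filterS2 fg0 h => y fgy.
  by rewrite !fctE /= fgy fgx.
have gu : 'd g x = 'd f x :> (V -> W) by apply: diff_unique.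
split; last exact: gu.
by apply/diff_locallyP; rewrite gu; split; [exact: dc|exact: gE].
Qed.

Lemma near_eq_diff (W : normedModType R) (f g : V -> W) (x v : V) :
  (\near x, f x = g x) -> differentiable f x -> 'd g x v = 'd f x v.
Proof. by move=> fg /(near_eq_is_diff fg)[_ ->]. Qed.

Lemma diff_compE (V' W : normedModType R) (f : V -> V') (g : V' -> W)
    (x v : V) (y : V') : f x = y -> differentiable f x -> differentiable g y ->
  differentiable (g \o f) x /\ 'd (g \o f) x v = 'd g y ('d f x v).
Proof.
move=> <- df dg; split; first exact: differentiable_comp.
by rewrite (diff_comp df dg).
Qed.

Lemma diff_translate (f : V -> R) (c y : V) : differentiable f (c + y) ->
  differentiable (fun y => f (c + y)) y /\
  forall v, 'D_v (fun y => f (c + y)) y = 'D_v f (c + y).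
Proof.
move=> d.
have dl : is_diff y (cst c + id : V -> V) (0 + id) :=
  is_diffD (is_diff_cst c y) (is_diff_id y).
have [dc E] := is_diff_comp dl (differentiableP d).
split=> [|v]; first exact: dc.
by rewrite deriveE; [rewrite [LHS](congr1 (@^~ v) E) /= fctE add0r deriveE|].
Qed.

Lemma is_derive_line (f : V -> R) (a v : V) (t : R) :
  differentiable f (a + t *: v) ->
  is_derive t 1 (fun s => f (a + s *: v)) ('D_v f (a + t *: v)).
Proof.
move=> df.
have dl : is_diff t (cst a + ( *:%R^~ v) : R -> V) (0 + ( *:%R^~ v)) :=
  is_diffD (is_diff_cst a t) (is_diff_scalel t v).
have [dc E] := is_diff_comp dl (differentiableP df).
apply: DeriveDef; first exact/derivable1_diffP.
by rewrite deriveE; [rewrite [LHS](congr1 (@^~ 1) E) /= fctE add0r scale1r deriveE|].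
Qed.

Lemma MVT_line (f : V -> R) (a v : V) (h : R) : 0 < h ->
  (forall t, 0 <= t <= h -> differentiable f (a + t *: v)) ->
  exists2 t, 0 < t < h & f (a + h *: v) - f a = h * 'D_v f (a + t *: v).
Proof.
move=> h0 df.
have d t : t \in `[0, h]%R ->
    is_derive t 1 (fun s => f (a + s *: v)) ('D_v f (a + t *: v)).
  by rewrite in_itv /= => th; exact/is_derive_line/df.
have fc : {within `[0, h], continuous (fun s => f (a + s *: v))}.
  by apply: derivable_within_continuous => x /d [].
have [c ch E] := @MVT R (fun s => f (a + s *: v))
  (fun t => 'D_v f (a + t *: v)) 0 h h0
  (fun x xh => d x (subset_itv_oo_cc xh)) fc.
exists c; first by move: ch; rewrite in_itv.
by move: E; rewrite scale0r addr0 subr0 mulrC.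
Qed.

End Line.

Section Second.
Context (R : realType) (V : normedModType R).

Lemma near_box (P : set V) (x v w : V) : nbhs x P ->
  exists2 r : R, 0 < r & forall s t, 0 <= s <= r -> 0 <= t <= r ->
    P (x + s *: v + t *: w).
Proof.
move=> /nbhs_ballP[e /= e0 eP].
have c0 : 0 < `|v| + `|w| + 1 by rewrite ltr_wpDl // addr_ge0.
exists (e / (`|v| + `|w| + 1) / 2); first by rewrite !divr_gt0.
move=> s t /andP[s0 sr] /andP[t0 tr]; apply: eP.
rewrite -ball_normE /= -addrA opprD addNKr normrN.
rewrite (le_lt_trans (ler_normD _ _)) // !normrZ !ger0_norm //.
set r := _ / 2 in sr tr.
have rE : r * (`|v| + `|w| + 1) = e / 2.
  by rewrite /r mulrAC divfK // gt_eqF.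
have r0 : 0 < r by rewrite !divr_gt0.
have h1 : s * `|v| <= r * `|v| by rewrite ler_wpM2r.
have h2 : t * `|w| <= r * `|w| by rewrite ler_wpM2r.
have : e / 2 < e by rewrite ltr_pdivrMr // ltr_pMr // ltr1n.
lra.
Qed.

Lemma near_segment (P : set V) (x v : V) : nbhs x P ->
  exists2 r : R, 0 < r & forall s, 0 <= s <= r -> P (x + s *: v).
Proof.
move=> /(near_box v 0)[r r0 h]; exists r => // s sr.
by have := h s 0 sr; rewrite scaler0 addr0; apply; rewrite lexx ltW.
Qed.

(** The mean value theorem is applied twice: along [v] to the increment of [f]
    by [r *: w], then along [w] to ['D_v f]. *)
Lemma second_difference (f : V -> R) (x v w : V) (r : R) : 0 < r ->
  (forall s t, 0 <= s <= r -> 0 <= t <= r ->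
     differentiable f (x + s *: v + t *: w)) ->
  (forall s t, 0 <= s <= r -> 0 <= t <= r ->
     differentiable (fun y => 'D_v f y) (x + s *: v + t *: w)) ->
  exists s t, [/\ 0 <= s <= r, 0 <= t <= r &
    f (x + r *: v + r *: w) - f (x + r *: v) - f (x + r *: w) + f x
    = r * r * 'D_w (fun y => 'D_v f y) (x + s *: v + t *: w)].
Proof.
move=> r0 df ddf.
have rr : 0 <= r <= r by rewrite lexx ltW.
have r00 : (0 : R) <= 0 <= r by apply/andP; split; [exact: lexx|exact: ltW].
pose F := (fun y => f (r *: w + y) - f y).
have addc y : x + y + r *: w = r *: w + (x + y) by rewrite addrC.
have dF t : 0 <= t <= r -> differentiable F (x + t *: v) /\
    'D_v F (x + t *: v) = 'D_v f (x + t *: v + r *: w) - 'D_v f (x + t *: v).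
  move=> tr; have d1 := df t r tr rr; have d2 := df t 0 tr r00.
  rewrite scale0r addr0 in d2; rewrite addc in d1 *.
  have [i1 D1] := diff_translate d1.
  split; first exact: differentiableB i1 d2.
  by rewrite -D1; apply: deriveB; apply: diff_derivable.
have [t /andP[/ltW t0 /ltW tr] E1] : exists2 t, 0 < t < r &
    F (x + r *: v) - F x = r * 'D_v F (x + t *: v).
  by apply: (MVT_line r0) => t' /dF [].
have tI : 0 <= t <= r by rewrite t0.
have [|u /andP[/ltW u0 /ltW ur] E2] :=
  @MVT_line _ _ (fun y => 'D_v f y) (x + t *: v) w r r0.
  by move=> u ur; exact: ddf.
exists t, u; split; rewrite ?t0 ?u0 //.
have [_ DFt] := dF t tI.
by rewrite -mulrA -E2 -DFt -E1 /F -[r *: w + x]addrC addc opprB [LHS]addrAC -addrA.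
Qed.

(** The second difference of [f] along [r *: v] and [r *: w] is symmetric in [v]
    and [w], so on every small box the two iterated derivatives share a value;
    they are continuous, hence equal at [x]. *)
Lemma Schwarz (W : set V) (f : V -> R) (x v w : V) : open W -> W x ->
  diff_upto 3 W f ->
  'D_w (fun y => 'D_v f y) x = 'D_v (fun y => 'D_w f y) x.
Proof.
move=> oW Wx [df ddf].
apply/eqP; rewrite -subr_eq0; apply/negPn/negP => ne.
pose G1 := fun y => 'D_w (fun y => 'D_v f y) y.
pose G2 := fun y => 'D_v (fun y => 'D_w f y) y.
have c1 : {for x, continuous G1}.
  by apply: differentiable_continuous; have [_ /(_ w)[h _]] := ddf v; exact: h.
have c2 : {for x, continuous G2}.
  by apply: differentiable_continuous; have [_ /(_ v)[h _]] := ddf w; exact: h.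
(* If the two limits differed, both functions would stay within half of their
   distance near [x], which leaves no common value. *)
pose e := `|G1 x - G2 x| / 2.
have e0 : 0 < e by rewrite divr_gt0 // normr_gt0.
have /cvgrPdist_lt/(_ _ e0) n1 := c1.
have /cvgrPdist_lt/(_ _ e0) n2 := c2.
have nW : nbhs x W by exact: open_nbhs_nbhs.
have [r r0 box] := near_box v w (filterI nW (filterI n1 n2)).
have [r' r'0 box'] := near_box w v (filterI nW (filterI n1 n2)).
pose q := Num.min r r'.
have q0 : 0 < q by rewrite lt_min r0.
have qr s : 0 <= s <= q -> 0 <= s <= r.
  by case/andP=> -> /= h; rewrite (le_trans h) // ge_min lexx.
have qr' s : 0 <= s <= q -> 0 <= s <= r'.
  by case/andP=> -> /= h; rewrite (le_trans h) // ge_min lexx orbT.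
have [|||s [t [sq tq E]]] := @second_difference f x v w q.
- by [].
- by move=> s t /qr sr /qr tr; apply: df; case: (box s t sr tr).
- move=> s t /qr sr /qr tr; have [h _] := ddf v.
  by apply: h; case: (box s t sr tr).
have [|||s' [t' [sq' tq' E']]] := @second_difference f x w v q.
- by [].
- by move=> s' t' /qr' sr /qr' tr; apply: df; case: (box' s' t' sr tr).
- move=> s' t' /qr' sr /qr' tr; have [h _] := ddf w.
  by apply: h; case: (box' s' t' sr tr).
have [_ [b1 _]] := box s t (qr _ sq) (qr _ tq).
have [_ [_ b2]] := box' s' t' (qr' _ sq') (qr' _ tq').
have EE : G1 (x + s *: v + t *: w) = G2 (x + s' *: w + t' *: v).
  have qq : q * q != 0 by rewrite mulf_neq0 // gt_eqF.
  apply: (mulfI qq); rewrite -[LHS]E -[RHS]E'.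
  by rewrite (addrAC x (q *: w)); congr (_ + _); exact: addrAC.
move: b1 b2; rewrite -EE; set z := G1 (_ + _) => b1 b2.
have b2' : `|z - G2 x| < e by rewrite distrC; exact: b2.
have := le_lt_trans (ler_distD z (G1 x) (G2 x)) (ltrD b1 b2').
by rewrite -splitr ltxx.
Qed.

(** If ['D_v f] were positive at [x], it would be so nearby, and [f] would
    increase from [x] in the direction [v]. *)
Lemma derive_at_max (f : V -> R) (x v : V) :
  (\near x, differentiable f x) -> {for x, continuous (fun y => 'D_v f y)} ->
  (\forall y \near x, f y <= f x) -> 'D_v f x <= 0.
Proof.
move=> df cf mx; rewrite leNgt; apply/negP => D0.
have /cvgrPdist_lt/(_ _ D0) n1 := cf.
have [r r0 h] := near_segment v (filterI df (filterI n1 mx)).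
have rr : 0 <= r <= r by rewrite lexx ltW.
have [|t /andP[/ltW t0 /ltW tr] E] := @MVT_line _ _ f x v _ r0.
  by move=> t /h[].
have [_ [_]] := h r rr; rewrite -subr_le0 E pmulr_rle0 //.
have [|_ [+ _]] := h t; first by rewrite t0.
rewrite ltr_distlC => /andP[+ _]; rewrite subrr => D1.
by rewrite leNgt D1.
Qed.

(** A positive second derivative at [x] would persist nearby; as ['D_v f x = 0],
    two applications of the mean value theorem would make [f] exceed its
    maximum. *)
Lemma second_derive_at_max (W : set V) (f : V -> R) (x v : V) :
  open W -> W x -> diff_upto 3 W f -> (\forall y \near x, f y <= f x) ->
  'D_v f x = 0 /\ 'D_v (fun y => 'D_v f y) x <= 0.
Proof.
move=> oW Wx [df ddf] mx.
have nW : nbhs x W by exact: open_nbhs_nbhs.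
have ndf : \near x, differentiable f x by apply: filterS nW.
have cD u : {for x, continuous (fun y => 'D_u f y)}.
  by apply: differentiable_continuous; have [h _] := ddf u; exact: h.
have D0 : 'D_v f x = 0.
  apply/eqP; rewrite eq_le derive_at_max //=.
  have dx : differentiable f x by exact: df.
  (* The other inequality is the same one in the direction [- v]. *)
  by rewrite -oppr_le0 deriveE // -linearN -deriveE // derive_at_max.
split=> //; rewrite leNgt; apply/negP => DD0.
have cDD : {for x, continuous (fun y => 'D_v (fun y => 'D_v f y) y)}.
  by apply: differentiable_continuous; have [_ /(_ v)[h _]] := ddf v; exact: h.
have /cvgrPdist_lt/(_ _ DD0) n1 := cDD.
have [r r0 h] := near_segment v (filterI nW (filterI n1 mx)).
have rr : 0 <= r <= r by rewrite lexx ltW.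
have [|t /andP[t0 /ltW tr] E] := @MVT_line _ _ f x v _ r0.
  by move=> t /h[/df].
have [_ [_]] := h r rr; rewrite -subr_le0 E pmulr_rle0 //.
have [|s /andP[/ltW s0 /ltW st] E'] :=
  @MVT_line _ _ (fun y => 'D_v f y) x v _ t0.
  move=> s /andP[s0 st]; have [|+ _] := h s; first by rewrite s0 (le_trans st).
  by have [d _] := ddf v; exact: d.
move: E'; rewrite D0 subr0 => ->; rewrite pmulr_rle0 //.
have [|_ [+ _]] := h s; first by rewrite s0 (le_trans st).
rewrite ltr_distlC => /andP[+ _]; rewrite subrr => D1.
by rewrite leNgt D1.
Qed.

Lemma diff0_locally_constant (W : set V) (f : V -> R) (x : V) :
  open W -> W x -> (forall y, W y -> differentiable f y) ->
  (forall y v, W y -> 'D_v f y = 0) -> \forall y \near x, f y = f x.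
Proof.
move=> oW Wx df D0.
have /nbhs_ballP[e /= e0 eW] : nbhs x W by exact: open_nbhs_nbhs.
apply/nbhs_ballP; exists e => //= y xy.
have h t : 0 <= t <= 1 -> W (x + t *: (y - x)).
  move=> /andP[t0 t1]; apply: eW; move: xy; rewrite -!ball_normE /= => xy.
  rewrite opprD addNKr normrN normrZ ger0_norm // (le_lt_trans _ xy) //.
  by rewrite distrC ler_piMl.
have [|t /andP[/ltW t0 /ltW t1]] := @MVT_line _ _ f x (y - x) _ ltr01.
  by move=> t /h/df.
rewrite D0; last by apply: h; rewrite t0.
by rewrite mulr0 scale1r [x + _]addrC subrK => /eqP; rewrite subr_eq0 => /eqP.
Qed.

End Second.

(** * Stability of smoothness *)

Section CinftyGen.
Context (R : realType) (V : normedModType R).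

Lemma diff_uptoS (V' : normedModType R) k (W : set V) (h : V -> V') :
  diff_upto k.+1 W h -> diff_upto k W h.
Proof.
elim: k h => // k IH h [dh dD]; split=> [x Wx|v]; first exact: dh.
exact: IH (dD v).
Qed.

Lemma diff_upto_subset (V' : normedModType R) k (W W' : set V) (h : V -> V') :
  W' `<=` W -> diff_upto k W h -> diff_upto k W' h.
Proof.
move=> sW; elim: k h => // k IH h [dh dD].
by split=> [x /sW Wx|v]; [exact: dh | exact: IH (dD v)].
Qed.

Lemma diff_upto_congr (V' : normedModType R) k (W : set V) (h h' : V -> V') :
  open W -> (forall x, W x -> h x = h' x) ->
  diff_upto k W h -> diff_upto k W h'.
Proof.
move=> oW; elim: k h h' => // k IH h h' hh' [dh dD].
have nhh' x : W x -> \near x, h x = h' x.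
  move=> Wx; have nW : nbhs x W by exact: open_nbhs_nbhs.
  exact: filterS hh' nW.
split=> [x Wx|v].
  by have [] := near_eq_is_diff (nhh' x Wx) (dh x Wx).
by apply: IH (dD v) => x Wx; exact: near_eq_derive (nhh' x Wx).
Qed.

Lemma diff_upto_cst (V' : normedModType R) k (W : set V) (c : V') :
  open W -> diff_upto k W (fun _ => c).
Proof.
move=> oW; elim: k c => // k IH c; split=> [x _|v].
  exact: (differentiable_cst c).
by apply: diff_upto_congr (IH 0) => // x _; rewrite (derive_cst c).
Qed.

Lemma diff_upto_add (V' : normedModType R) k (W : set V) (f g : V -> V') :
  open W -> diff_upto k W f -> diff_upto k W g ->
  diff_upto k W (fun x => f x + g x).
Proof.
move=> oW; elim: k f g => // k IH f g [df Df] [dg Dg]; split=> [x Wx|v].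
  exact: differentiableD (df x Wx) (dg x Wx).
apply: diff_upto_congr (IH _ _ (Df v) (Dg v)) => // x Wx.
by symmetry; apply: deriveD; apply: diff_derivable; [exact: df|exact: dg].
Qed.

Lemma diff_upto_sum (V' : normedModType R) k (W : set V) (I : Type)
    (r : seq I) (f : I -> V -> V') :
  open W -> (forall i, diff_upto k W (f i)) ->
  diff_upto k W (fun x => \sum_(i <- r) f i x).
Proof.
move=> oW df; elim: r => [|i r IH].
  apply: diff_upto_congr (diff_upto_cst k 0 oW) => // x _.
  by rewrite big_nil.
apply: diff_upto_congr (diff_upto_add oW (df i) IH) => // x _.
by rewrite big_cons.
Qed.

Lemma diff_upto_lin (V' V'' : normedModType R) k (W : set V)
    (L : {linear V' -> V''}) (f : V -> V') :
  open W -> continuous L -> diff_upto k W f -> diff_upto k W (L \o f).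
Proof.
move=> oW cL; elim: k f => // k IH f [df Df].
have dL y : differentiable L y by exact: linear_differentiable.
split=> [x Wx|v]; first exact: differentiable_comp (df x Wx) (dL _).
apply: diff_upto_congr (IH _ (Df v)) => // x Wx /=.
have dLf := differentiable_comp (df x Wx) (dL _).
rewrite (@deriveE _ _ _ _ _ v (df x Wx)) (@deriveE _ _ _ _ _ v dLf).
by rewrite (diff_comp (df x Wx) (dL _)) diff_lin.
Qed.

Lemma diff_upto_mul k (W : set V) (f g : V -> R) :
  open W -> diff_upto k W f -> diff_upto k W g ->
  diff_upto k W (fun x => f x * g x).
Proof.
move=> oW; elim: k f g => // k IH f g Sf Sg.
have [[df Df] [dg Dg]] := (Sf, Sg).
split=> [x Wx|v]; first exact: differentiableM (df x Wx) (dg x Wx).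
apply: diff_upto_congr (diff_upto_add oW (IH _ _ (diff_uptoS Sf) (Dg v))
  (IH _ _ (diff_uptoS Sg) (Df v))) => // x Wx.
by symmetry; apply: deriveM; apply: diff_derivable; [exact: df|exact: dg].
Qed.

End CinftyGen.

Section CinftyRow.
Context (R : realType) (n : nat).

Lemma diff_row_sum (V' : normedModType R) (f : 'rV[R]_n -> V')
    (x v : 'rV[R]_n) : 'd f x v = \sum_k v 0 k *: 'd f x (delta_mx 0 k).
Proof.
rewrite {1}[v]row_sum_delta linear_sum /=.
by apply: eq_bigr => k _; rewrite linearZ.
Qed.

Definition row_entry (k : 'I_n) : 'rV[R]_n -> R := fun v => v 0 k.
Lemma row_entry_is_linear k : linear (row_entry k).
Proof. by move=> a u v; rewrite /row_entry !mxE. Qed.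
HB.instance Definition _ k :=
  GRing.isLinear.Build R 'rV[R]_n R _ (row_entry k) (row_entry_is_linear k).

Lemma row_entry_continuous k : continuous (row_entry k).
Proof. by move=> v; exact: differentiable_continuous (differentiable_coord v 0 k). Qed.

Lemma diff_upto_coord (V : normedModType R) k (W : set V) (f : V -> 'rV[R]_n) j :
  open W -> diff_upto k W f -> diff_upto k W (fun x => f x 0 j).
Proof.
by move=> oW; apply: (diff_upto_lin (L := row_entry j)) => //;
  exact: row_entry_continuous.
Qed.

(** The derivative of a composite is a sum of products of directional derivatives
    of [h], composed with [f], and components of derivatives of [f]; so one order
    of differentiability is handled at a time by induction. *)
Lemma diff_upto_comp (V : normedModType R) k (W : set V) (W' : set 'rV[R]_n)
    (f : V -> 'rV[R]_n) (h : 'rV[R]_n -> R) :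
  open W -> (forall x, W x -> W' (f x)) ->
  diff_upto k W f -> diff_upto k W' h -> diff_upto k W (h \o f).
Proof.
move=> oW fW; elim: k f fW h => // k IH f fW h Sf [dh Dh].
have [df Df] := Sf.
split=> [x Wx|v]; first exact: differentiable_comp (df x Wx) (dh _ (fW x Wx)).
have S : diff_upto k W (fun x => \sum_j ('D_v f x) 0 j * 'D_(delta_mx 0 j) h (f x)).
  apply: diff_upto_sum => // j; apply: diff_upto_mul => //.
    exact: (diff_upto_coord j oW (Df v)).
  exact: (IH f fW (fun y => 'D_(delta_mx 0 j) h y) (diff_uptoS Sf) (Dh _)).
apply: diff_upto_congr S => // x Wx.
have dfx := df x Wx; have dhx := dh _ (fW x Wx).
rewrite (@deriveE _ _ _ _ _ v (differentiable_comp dfx dhx)).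
rewrite (diff_comp dfx dhx) /= diff_row_sum; apply: eq_bigr => j _.
by rewrite (@deriveE _ _ _ _ _ v dfx) (@deriveE _ _ _ _ _ _ dhx).
Qed.

Lemma differentiable_row (V : normedModType R) (f : V -> 'rV[R]_n) x :
  (forall j, differentiable (fun y => f y 0 j) x) -> differentiable f x.
Proof.
move=> df.
have -> : f = \sum_j (fun y => f y 0 j *: delta_mx 0 j).
  by apply/funext => y; rewrite fct_sumE -row_sum_delta.
by apply: differentiable_sum => j; exact: differentiableZl.
Qed.

End CinftyRow.

(** * Charts and tangent vectors *)

Section Charts.
Context (R : realType) (n : nat) (M : topologicalType).
Context (A : smooth_manifold R n M).
Implicit Types (U : set M) (i j : chart_index A) (p q : M).

Local Notation x_ := (chart_map A).
Local Notation y_ := (chart_inv A).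
Local Notation dom := (chart_dom A).

Lemma open_dom i : open (dom i). Proof. exact: chart_dom_open. Qed.
Lemma open_domI U i : open U -> open (U `&` dom i).
Proof. by move=> oU; exact: openI oU (open_dom i). Qed.

Lemma near_chart_inv i p (Q : set M) : dom i p -> nbhs p Q ->
  \forall z \near x_ i p, Q (y_ i z).
Proof.
move=> ip Qp; have c : {for x_ i p, continuous (y_ i)}.
  by apply: chart_inv_continuous; exists p.
by apply: c; rewrite chart_mapK.
Qed.

Lemma near_chart_map i p (Q : set 'rV[R]_n) : dom i p -> nbhs (x_ i p) Q ->
  \forall q \near p, Q (x_ i q).
Proof. by move=> ip Qp; exact: (chart_map_continuous ip). Qed.

Lemma open_chart_image i U : open U -> open (x_ i @` (U `&` dom i)).
Proof.
move=> oU; rewrite openE => _ [p [Up ip] <-]; rewrite /interior.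
have n1 : nbhs (x_ i p) (x_ i @` dom i).
  by apply: open_nbhs_nbhs; split; [exact: chart_image_open|exists p].
have n2 : nbhs (x_ i p) (y_ i @^-1` U).
  by apply: near_chart_inv => //; exact: open_nbhs_nbhs.
apply: filterS2 n1 n2 => _ [q iq <-] /=; rewrite chart_mapK // => Uq.
by exists q.
Qed.

Lemma mem_chart_image i U p : U p -> dom i p -> (x_ i @` (U `&` dom i)) (x_ i p).
Proof. by move=> Up ip; exists p. Qed.

Lemma chart_image_open_nbhs i U p : open U -> U p -> dom i p ->
  nbhs (x_ i p) (x_ i @` (U `&` dom i)).
Proof.
move=> oU Up ip; apply: open_nbhs_nbhs; split; first exact: open_chart_image.
exact: mem_chart_image.
Qed.

Lemma transition_diff i j p : dom i p -> dom j p ->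
  differentiable (x_ j \o y_ i) (x_ i p).
Proof.
by move=> ip jp; have [d _] := transition_smooth i j 1; apply: d; exists p.
Qed.

Lemma smooth_on_subset U V (f : M -> R) : V `<=` U ->
  smooth_on A U f -> smooth_on A V f.
Proof.
move=> VU Sf i k; apply: diff_upto_subset (Sf i k) => _ [q [/VU Uq iq] <-].
by exists q.
Qed.

Lemma smooth_on_congr U (f g : M -> R) : open U -> (forall p, U p -> f p = g p) ->
  smooth_on A U f -> smooth_on A U g.
Proof.
move=> oU fg Sf i k; apply: diff_upto_congr (Sf i k).
  exact: open_chart_image.
by move=> _ [q [Uq iq] <-] /=; rewrite chart_mapK // fg.
Qed.

Lemma smooth_on_cst U (c : R) : open U -> smooth_on A U (fun=> c).
Proof. by move=> oU i k; apply: diff_upto_cst; exact: open_chart_image. Qed.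

Lemma smooth_onD U (f g : M -> R) : open U -> smooth_on A U f ->
  smooth_on A U g -> smooth_on A U (fun p => f p + g p).
Proof.
move=> oU Sf Sg i k.
exact: (diff_upto_add (f := f \o y_ i) (g := g \o y_ i)
  (open_chart_image oU) (Sf i k) (Sg i k)).
Qed.

Lemma smooth_onM U (f g : M -> R) : open U -> smooth_on A U f ->
  smooth_on A U g -> smooth_on A U (fun p => f p * g p).
Proof.
move=> oU Sf Sg i k.
exact: (diff_upto_mul (f := f \o y_ i) (g := g \o y_ i)
  (open_chart_image oU) (Sf i k) (Sg i k)).
Qed.

Lemma smooth_on_diff U (f : M -> R) i p : smooth_on A U f -> U p -> dom i p ->
  differentiable (f \o y_ i) (x_ i p).
Proof. by move=> Sf Up ip; have [d _] := Sf i 1; apply: d; exists p. Qed.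

Lemma smooth_on_continuous U (f : M -> R) p : open U -> smooth_on A U f ->
  U p -> {for p, continuous f}.
Proof.
move=> oU Sf Up; pose i := chart_at A p; have ip : dom i p by exact: chart_atP.
have c1 := differentiable_continuous (smooth_on_diff Sf Up ip).
have c2 : {for p, continuous ((f \o y_ i) \o x_ i)}.
  by apply: continuous_comp c1; exact: chart_map_continuous.
have E : \near p, ((f \o y_ i) \o x_ i) p = f p.
  apply: filterS (open_nbhs_nbhs (conj (open_dom i) ip)) => q iq /=.
  by rewrite chart_mapK.
rewrite /prop_for /continuous_at -(nbhs_singleton E).
by apply: cvg_trans c2; apply: near_eq_cvg.
Qed.

(** The expressions of [f] in the other charts are obtained by composition with
    transition maps. *)
Lemma smooth_on_chart U i (f : M -> R) : open U -> U `<=` dom i ->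
  Cinfty_on (x_ i @` (U `&` dom i)) (f \o y_ i) -> smooth_on A U f.
Proof.
move=> oU Ui Sf j k; have oW := @open_chart_image j _ oU.
have St : diff_upto k (x_ j @` (U `&` dom j)) (x_ i \o y_ j).
  apply: diff_upto_subset (transition_smooth j i k) => _ [q [Uq jq] <-].
  by exists q => //; split=> //; exact: Ui.
apply: diff_upto_congr (diff_upto_comp oW _ St (Sf k)) => //.
  by move=> _ [q [Uq jq] <-] /=; rewrite !chart_mapK //; exact: Ui.
by move=> _ [q [Uq jq] <-] /=; rewrite chart_mapK //; exists q => //; split=> //; exact: Ui.
Qed.

Section TangentF.
Context (V : normedModType R).
Implicit Types F G : M -> V.

Lemma tdiffD F p (v w : 'rV[R]_n) : tdiff A F p (v + w) = tdiff A F p v + tdiff A F p w.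
Proof. exact: linearD. Qed.
Lemma tdiffZ F p (a : R) (v : 'rV[R]_n) : tdiff A F p (a *: v) = a *: tdiff A F p v.
Proof. exact: linearZ. Qed.
Lemma tdiff0 F p : tdiff A F p 0 = 0.
Proof. exact: linear0. Qed.
Lemma tdiff_sum F p I (r : seq I) (v : I -> 'rV[R]_n) :
  tdiff A F p (\sum_(k <- r) v k) = \sum_(k <- r) tdiff A F p (v k).
Proof. exact: linear_sum. Qed.

(** Differentials are defined in the preferred chart of [p]; by the chain rule
    any chart around [p] computes them, once the tangent vector is expressed in
    that chart. *)
Lemma tdiff_chart F i p (v : 'rV[R]_n) : dom i p ->
  differentiable (F \o y_ i) (x_ i p) ->
  tdiff A F p v = 'd (F \o y_ i) (x_ i p) (tdiff A (x_ i) p v).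
Proof.
move=> ip dF; rewrite /tdiff; set c := chart_at A p.
have cp : dom c p by exact: chart_atP.
have dt := transition_diff cp ip.
have E0 : (x_ i \o y_ c) (x_ c p) = x_ i p by rewrite /= chart_mapK.
have [dc Ec] := diff_compE v E0 dt dF.
have E : \forall z \near x_ c p,
      ((F \o y_ i) \o (x_ i \o y_ c)) z = (F \o y_ c) z.
  have := near_chart_inv cp (open_nbhs_nbhs (conj (open_dom i) ip)).
  by apply: filterS => z iz /=; rewrite chart_mapK.
apply: etrans Ec.
exact: (@near_eq_diff R _ V ((F \o y_ i) \o (x_ i \o y_ c)) (F \o y_ c)).
Qed.

Lemma tdiff_near_eq F G p v : (\near p, F p = G p) ->
  differentiable (F \o y_ (chart_at A p)) (x_ (chart_at A p) p) ->
  tdiff A F p v = tdiff A G p v.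
Proof.
move=> FG dF; symmetry.
exact: near_eq_diff (near_chart_inv (chart_atP A p) FG) dF.
Qed.

End TangentF.

Lemma transition_inverse i j p (v : 'rV[R]_n) : dom i p -> dom j p ->
  'd (x_ i \o y_ j) (x_ j p) ('d (x_ j \o y_ i) (x_ i p) v) = v.
Proof.
move=> ip jp.
have d1 := transition_diff ip jp; have d2 := transition_diff jp ip.
have E0 : (x_ j \o y_ i) (x_ i p) = x_ j p by rewrite /= chart_mapK.
have [dc <-] := diff_compE v E0 d1 d2.
have E : \forall z \near x_ i p,
      ((x_ i \o y_ j) \o (x_ j \o y_ i)) z = id z.
  have n1 := near_chart_inv ip (open_nbhs_nbhs (conj (open_dom j) jp)).
  have n2 := chart_image_open_nbhs openT I ip.
  apply: filterS2 n1 n2 => z jz [q [_ iq] qz] /=.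
  by move: jz; rewrite -qz chart_mapK // => jq; rewrite !chart_mapK.
rewrite -(near_eq_diff v E dc).
by have := congr1 (@^~ v) (@diff_val _ _ _ _ _ _ _ (is_diff_id (x_ i p))).
Qed.

Lemma tdiff_chart_at p (v : 'rV[R]_n) : tdiff A (x_ (chart_at A p)) p v = v.
Proof.
have cp := chart_atP A p.
by have := transition_inverse v cp cp; rewrite -tdiff_chart //; apply: transition_diff.
Qed.

Lemma tdiff_coord_vfield (V : normedModType R) (F : M -> V) i k p : dom i p ->
  differentiable (F \o y_ i) (x_ i p) ->
  vder A (coord_vfield i k) F p = 'd (F \o y_ i) (x_ i p) (delta_mx 0 k).
Proof.
move=> ip dF; rewrite /vder (tdiff_chart _ ip dF) /coord_vfield.
by congr ('d _ _ _); rewrite /tdiff transition_inverse //; exact: chart_atP.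
Qed.

Lemma coord_vfield_components i k p : dom i p ->
  vder A (coord_vfield i k) (x_ i) p = delta_mx 0 k.
Proof.
move=> ip; rewrite /vder /coord_vfield /tdiff transition_inverse //.
exact: chart_atP.
Qed.

(** This turns the traces in the Ricci and scalar curvatures into sums over
    the standard basis of row vectors. *)
Lemma coord_vfield_at p k : coord_vfield (chart_at A p) k p = delta_mx 0 k.
Proof.
have cp := chart_atP A p.
by rewrite -[LHS](tdiff_chart_at p) -/(vder _ _ _ _) coord_vfield_components.
Qed.

Lemma frame_expansion i p (v : 'rV[R]_n) : dom i p ->
  v = \sum_k tdiff A (x_ i) p v 0 k *: coord_vfield i k p.
Proof.
move=> ip.
have /esym vE := transition_inverse v (chart_atP A p) ip.
by rewrite {1}vE diff_row_sum.
Qed.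

End Charts.

(** * Vector fields and the Lie bracket *)

Lemma diff_coord (R : realType) (V : normedModType R) n (f : V -> 'rV[R]_n)
    (x v : V) k : differentiable f x ->
  differentiable (fun y => f y 0 k) x /\
  ('d f x v) 0 k = 'd (fun y => f y 0 k) x v.
Proof.
move=> df; have dL : differentiable (@row_entry R n k) (f x).
  by apply: linear_differentiable; exact: row_entry_continuous.
have [dc E] := diff_compE v erefl df dL.
split; first exact: dc.
by rewrite [RHS]E (diff_lin _ (@row_entry_continuous R n k)).
Qed.

Section VFields.
Context (R : realType) (n : nat) (M : topologicalType).
Context (A : smooth_manifold R n M).
Implicit Types (U : set M) (i j : chart_index A) (p q : M) (X Y Z : vfield R n M).

Local Notation x_ := (chart_map A).
Local Notation y_ := (chart_inv A).
Local Notation dom := (chart_dom A).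

Lemma vderE U (f : M -> R) i X p : smooth_on A U f -> U p -> dom i p ->
  vder A X f p = \sum_k vder A X (x_ i) p 0 k
                   * 'D_(delta_mx 0 k) (f \o y_ i) (x_ i p).
Proof.
move=> Sf Up ip; have df := smooth_on_diff Sf Up ip.
rewrite /vder (tdiff_chart _ ip df) diff_row_sum; apply: eq_bigr => k _.
by rewrite (@deriveE _ _ _ _ _ _ df).
Qed.

Lemma vder_coord_vfield U (f : M -> R) i k p : smooth_on A U f -> U p -> dom i p ->
  vder A (coord_vfield i k) f p = 'D_(delta_mx 0 k) (f \o y_ i) (x_ i p).
Proof.
move=> Sf Up ip; have df := smooth_on_diff Sf Up ip.
by rewrite tdiff_coord_vfield // (@deriveE _ _ _ _ _ _ df).
Qed.

Lemma vder_derive U (f : M -> R) X p : smooth_on A U f -> U p ->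
  vder A X f p = 'D_(X p) (f \o y_ (chart_at A p)) (x_ (chart_at A p) p).
Proof.
move=> Sf Up; have df := smooth_on_diff Sf Up (chart_atP A p).
by rewrite (@deriveE _ _ _ _ _ _ df).
Qed.

Lemma vder_congr U (f g : M -> R) X p : open U -> smooth_on A U f ->
  (forall q, U q -> f q = g q) -> U p -> vder A X f p = vder A X g p.
Proof.
move=> oU Sf fg Up; apply: tdiff_near_eq.
  by apply: filterS (open_nbhs_nbhs (conj oU Up)) => q; exact: fg.
exact: smooth_on_diff Sf Up (chart_atP A p).
Qed.

Lemma vder_fctD U (f g : M -> R) X p : open U -> smooth_on A U f ->
  smooth_on A U g -> U p ->
  vder A X (fun q => f q + g q) p = vder A X f p + vder A X g p.
Proof.
move=> oU Sf Sg Up; rewrite !(vder_derive _ _ Up) //; last exact: smooth_onD.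
have df := smooth_on_diff Sf Up (chart_atP A p).
have dg := smooth_on_diff Sg Up (chart_atP A p).
exact: (@deriveD _ _ _ (f \o y_ _) (g \o y_ _) _ _
  (diff_derivable df) (diff_derivable dg)).
Qed.

Lemma vder_fctM U (f g : M -> R) X p : open U -> smooth_on A U f ->
  smooth_on A U g -> U p ->
  vder A X (fun q => f q * g q) p = f p * vder A X g p + g p * vder A X f p.
Proof.
move=> oU Sf Sg Up; rewrite !(vder_derive _ _ Up) //; last exact: smooth_onM.
have df := smooth_on_diff Sf Up (chart_atP A p).
have dg := smooth_on_diff Sg Up (chart_atP A p).
apply: etrans (@deriveM _ _ (f \o y_ _) (g \o y_ _) _ _
  (diff_derivable df) (diff_derivable dg)) _.
by rewrite /= chart_mapK //; exact: chart_atP.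
Qed.

Lemma vder_cst X (c : R) p : vder A X (fun=> c) p = 0.
Proof. by rewrite /vder /tdiff (diff_cst c). Qed.

Lemma smooth_on_sum U I (r : seq I) (f : I -> M -> R) : open U ->
  (forall k, smooth_on A U (f k)) -> smooth_on A U (fun p => \sum_(k <- r) f k p).
Proof.
move=> oU Sf i k.
apply: diff_upto_congr (diff_upto_sum r (open_chart_image (i := i) oU)
  (fun l => Sf l i k)) => //; exact: open_chart_image.
Qed.

Lemma vder_fct_sum U I (r : seq I) (f : I -> M -> R) X p : open U ->
  (forall k, smooth_on A U (f k)) -> U p ->
  vder A X (fun q => \sum_(k <- r) f k q) p = \sum_(k <- r) vder A X (f k) p.
Proof.
move=> oU Sf Up; elim: r => [|k r IH].
  rewrite big_nil -[RHS](vder_cst X 0 p); congr (vder _ _ _ _).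
  by apply/funext => q; rewrite big_nil.
rewrite big_cons -IH -(vder_fctD _ oU (Sf k) (smooth_on_sum r oU Sf) Up).
by congr (vder _ _ _ _); apply/funext => q; rewrite big_cons.
Qed.

Lemma smooth_vfield_subset U V X : V `<=` U ->
  smooth_vfield_on A U X -> smooth_vfield_on A V X.
Proof.
move=> VU SX i k; apply: smooth_on_subset (SX i k) => q [/VU]; by split.
Qed.

Lemma smooth_vfield_congr U X Y : open U -> (forall p, U p -> X p = Y p) ->
  smooth_vfield_on A U X -> smooth_vfield_on A U Y.
Proof.
move=> oU XY SX i k; apply: smooth_on_congr (SX i k) => [|p [Up ip]].
  exact: open_domI.
by rewrite /vder XY.
Qed.

Lemma smooth_vfieldD U X Y : open U -> smooth_vfield_on A U X ->
  smooth_vfield_on A U Y -> smooth_vfield_on A U (fun p => X p + Y p).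
Proof.
move=> oU SX SY i k; have oUi := open_domI i oU.
apply: smooth_on_congr (smooth_onD oUi (SX i k) (SY i k)) => // p _.
by rewrite /vder tdiffD mxE.
Qed.

Lemma smooth_vfieldZ U f X : open U -> smooth_on A U f ->
  smooth_vfield_on A U X -> smooth_vfield_on A U (fun p => f p *: X p).
Proof.
move=> oU Sf SX i k; have oUi := open_domI i oU.
have Sf' : smooth_on A (U `&` dom i) f by apply: smooth_on_subset Sf => q [].
apply: smooth_on_congr (smooth_onM oUi Sf' (SX i k)) => // p _.
by rewrite /vder tdiffZ mxE.
Qed.

Lemma smooth_vfield0 U : open U -> smooth_vfield_on A U (fun=> 0).
Proof.
move=> oU i k; have oUi := open_domI i oU.
by apply: smooth_on_congr (smooth_on_cst 0 oUi) => // p _; rewrite /vder tdiff0 mxE.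
Qed.

Lemma smooth_vfieldB U X Y : open U -> smooth_vfield_on A U X ->
  smooth_vfield_on A U Y -> smooth_vfield_on A U (fun p => X p - Y p).
Proof.
move=> oU SX SY.
have SY' := smooth_vfieldZ oU (smooth_on_cst (-1) oU) SY.
apply: smooth_vfield_congr (smooth_vfieldD oU SX SY') => // p _.
by rewrite scaleN1r.
Qed.

Lemma smooth_vfield_sum U I (r : seq I) (X : I -> vfield R n M) : open U ->
  (forall k, smooth_vfield_on A U (X k)) ->
  smooth_vfield_on A U (fun p => \sum_(k <- r) X k p).
Proof.
move=> oU SX; elim: r => [|k r IH].
  by apply: smooth_vfield_congr (smooth_vfield0 oU) => // p _; rewrite big_nil.
apply: smooth_vfield_congr (smooth_vfieldD oU (SX k) IH) => // p _.
by rewrite big_cons.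
Qed.

(** In the chart [j], the components of the [k]-th coordinate field of the chart
    [i] are the [k]-th partial derivatives of the transition map. *)
Lemma coord_vfield_smooth i k : smooth_vfield_on A (dom i) (coord_vfield i k).
Proof.
move=> j l; have o := openI (open_dom (A := A) i) (open_dom (A := A) j).
apply: (smooth_on_chart (i := i) o) => [q []//|m].
have [_ /(_ (delta_mx 0 k)) S] := transition_smooth i j m.+1.
have oW := open_chart_image (i := i) o.
have sub : x_ i @` ((dom i `&` dom j) `&` dom i) `<=` x_ i @` (dom i `&` dom j).
  by move=> _ [q [ijq _] <-]; exists q.
apply: diff_upto_congr (diff_upto_coord l oW (diff_upto_subset sub S)) => //.
move=> _ [q [[iq jq] _] <-] /=; rewrite chart_mapK //.
have dt := transition_diff iq jq.
by rewrite tdiff_coord_vfield // (@deriveE _ _ _ _ _ _ dt).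
Qed.

(** The product rule for [Y(f) = \sum_k Y^k d_k f] in the preferred chart of
    [p]: the first terms carry the second derivatives of [f], and the factors
    [X(Y^k)] of the others are what the Lie bracket is made of. *)
Lemma vder_vder U X Y (f : M -> R) p (c := chart_at A p) : open U ->
  smooth_vfield_on A U Y -> smooth_on A U f -> U p ->
  vder A X (vder A Y f) p
  = \sum_k (Y p 0 k * 'D_(X p) (fun z => 'D_(delta_mx 0 k) (f \o y_ c) z) (x_ c p)
      + 'D_(delta_mx 0 k) (f \o y_ c) (x_ c p) * vder A X (vder A Y (x_ c)) p 0 k).
Proof.
move=> oU SY Sf Up; have cp : dom c p := chart_atP A p.
pose F := f \o y_ c; pose e := vder A Y (x_ c) \o y_ c.
have de k : differentiable (fun z => e z 0 k) (x_ c p).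
  have := SY c k; move=> /(_ c 1)[d _]; apply: d; exists p => //.
have dE : differentiable e (x_ c p) by apply: differentiable_row.
have [_ DF] := Sf c 2.
have dF k : differentiable (fun z => 'D_(delta_mx 0 k) F z) (x_ c p).
  by have [h _] := DF (delta_mx 0 k); apply: h; exists p.
pose G := \sum_k (fun z => e z 0 k * 'D_(delta_mx 0 k) F z).
have dG : differentiable G (x_ c p).
  by apply: differentiable_sum => k; exact: differentiableM.
have GE : \forall z \near x_ c p, G z = (vder A Y f \o y_ c) z.
  apply: filterS (chart_image_open_nbhs oU Up cp) => _ [q [Uq cq] <-].
  rewrite [RHS]/= chart_mapK // (vderE _ Sf Uq cq) /G fct_sumE.
  by apply: eq_bigr => k _; rewrite /e /= chart_mapK.
have ep k : e (x_ c p) 0 k = Y p 0 k.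
  by rewrite /e /= chart_mapK // /vder tdiff_chart_at.
rewrite [LHS](near_eq_diff _ GE dG) -(@deriveE _ _ _ _ _ _ dG) derive_sum; last first.
  by move=> k; apply: diff_derivable; exact: differentiableM.
apply: eq_bigr => k _.
apply: etrans (@deriveM _ _ (fun z => e z 0 k) _ _ _
  (diff_derivable (de k)) (diff_derivable (dF k))) _.
rewrite ep /vder /tdiff; have [_ ->] := diff_coord (X p) k dE.
by rewrite (@deriveE _ _ _ _ _ _ (de k)).
Qed.

(** In [X(Y(f)) - Y(X(f))] the second derivatives of [f] cancel by Schwarz. *)
Lemma vder_bracket U X Y (f : M -> R) p : open U -> smooth_vfield_on A U X ->
  smooth_vfield_on A U Y -> smooth_on A U f -> U p ->
  vder A (bracket A X Y) f p = vder A X (vder A Y f) p - vder A Y (vder A X f) p.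
Proof.
move=> oU SX SY Sf Up.
rewrite !(vder_vder _ oU _ Sf Up) //; set c := chart_at A p.
have cp : dom c p := chart_atP A p.
rewrite (vderE _ Sf Up cp) !big_split /= opprD addrACA.
set S1 := (X in _ = X + _); have -> : S1 = 0.
  pose DD l k := 'D_(delta_mx 0 l)
    (fun z => 'D_(delta_mx 0 k) (f \o y_ c) z) (x_ c p).
  have dd a k : 'D_a (fun z => 'D_(delta_mx 0 k) (f \o y_ c) z) (x_ c p)
      = \sum_l a 0 l * DD l k.
    have [_ DF] := Sf c 2.
    have dF : differentiable (fun z => 'D_(delta_mx 0 k) (f \o y_ c) z) (x_ c p).
      by have [h _] := DF (delta_mx 0 k); apply: h; exists p.
    rewrite (@deriveE _ _ _ _ _ _ dF) diff_row_sum; apply: eq_bigr => l _.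
    by rewrite /DD (@deriveE _ _ _ _ _ _ dF).
  have DDC l k : DD l k = DD k l.
    exact: (Schwarz _ _ (open_chart_image oU) (mem_chart_image Up cp) (Sf c 3)).
  apply/eqP; rewrite subr_eq0; apply/eqP.
  transitivity (\sum_k \sum_l Y p 0 k * (X p 0 l * DD l k)).
    by apply: eq_bigr => k _; rewrite dd mulr_sumr.
  rewrite exchange_big /=; apply: eq_bigr => l _.
  rewrite dd mulr_sumr; apply: eq_bigr => k _.
  by rewrite mulrCA DDC.
rewrite add0r -sumrB; apply: eq_bigr => k _.
by rewrite /vder tdiff_chart_at /bracket -/c !mxE mulrC mulrBr.
Qed.

End VFields.

(** * Connections *)

Section Connection.
Context (R : realType) (n : nat) (M : topologicalType).
Context (A : smooth_manifold R n M).
Context (nabla : vfield R n M -> vfield R n M -> vfield R n M).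
Context (hn : affine_connection A nabla).
Implicit Types (U : set M) (i : chart_index A) (p q : M) (X Y Z W : vfield R n M).

Local Notation x_ := (chart_map A).
Local Notation dom := (chart_dom A).

Lemma nabla0r U X p : open U -> U p -> smooth_vfield_on A U X ->
  nabla X (fun=> 0) p = 0.
Proof.
move=> oU Up SX; have S0 := smooth_vfield0 (A := A) oU.
have := connection_additive hn oU SX S0 S0 Up.
have -> : (fun q : M => 0 + 0) = (fun=> 0) :> vfield R n M.
  by apply/funext => q; rewrite addr0.
by rewrite -[X in X = _]addr0 => /addrI.
Qed.

(** Smoothness on [U] says nothing outside [U], so this discontinuous indicator
    is smooth on [U]. It fixes by multiplication every field that vanishes on
    [U]; the Leibniz rule then shows that [nabla] is local, without bump
    functions. *)
Definition outside (U : set M) : M -> R := fun q => if `[< U q >] then 0 else 1.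

Lemma outside_in U q : U q -> outside U q = 0.
Proof. by move=> Uq; rewrite /outside; case: asboolP. Qed.

Lemma outside_smooth U : open U -> smooth_on A U (outside U).
Proof.
move=> oU; apply: smooth_on_congr (smooth_on_cst 0 oU) => // q Uq.
by rewrite outside_in.
Qed.

Lemma outside_scale U X : (forall q, U q -> X q = 0) ->
  X = (fun q => outside U q *: X q).
Proof.
move=> X0; apply/funext => q; rewrite /outside; case: asboolP => [/X0 ->|_].
  by rewrite scaler0.
by rewrite scale1r.
Qed.

Lemma nabla_vanish_r U X Y p : open U -> U p -> smooth_vfield_on A U X ->
  smooth_vfield_on A U Y -> (forall q, U q -> Y q = 0) -> nabla X Y p = 0.
Proof.
move=> oU Up SX SY Y0.
have := connection_leibniz hn oU (outside_smooth oU) SX SY Up.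
by rewrite -(outside_scale Y0) outside_in // scale0r addr0 Y0 // scaler0.
Qed.

Lemma nablaDr U X Y Z p : open U -> U p -> smooth_vfield_on A U X ->
  smooth_vfield_on A U Y -> smooth_vfield_on A U Z ->
  nabla X (fun q => Y q + Z q) p = nabla X Y p + nabla X Z p.
Proof. by move=> oU Up SX SY SZ; exact: (connection_additive hn oU SX SY SZ Up). Qed.

Lemma nablaBr U X Y Z p : open U -> U p -> smooth_vfield_on A U X ->
  smooth_vfield_on A U Y -> smooth_vfield_on A U Z ->
  nabla X (fun q => Y q - Z q) p = nabla X Y p - nabla X Z p.
Proof.
move=> oU Up SX SY SZ.
have E : (fun q => (Y q - Z q) + Z q) = Y.
  by apply/funext => q; rewrite subrK.
have := nablaDr oU Up SX (smooth_vfieldB oU SY SZ) SZ.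
by rewrite E => ->; rewrite addrK.
Qed.

Lemma nablaZcr U (c : R) X Y p : open U -> U p -> smooth_vfield_on A U X ->
  smooth_vfield_on A U Y -> nabla X (fun q => c *: Y q) p = c *: nabla X Y p.
Proof.
move=> oU Up SX SY.
rewrite (connection_leibniz hn oU (smooth_on_cst c oU) SX SY Up).
by rewrite vder_cst scale0r add0r.
Qed.

Lemma nabla_sumr U I (r : seq I) X (Y : I -> vfield R n M) p : open U -> U p ->
  smooth_vfield_on A U X -> (forall k, smooth_vfield_on A U (Y k)) ->
  nabla X (fun q => \sum_(k <- r) Y k q) p = \sum_(k <- r) nabla X (Y k) p.
Proof.
move=> oU Up SX SY; elim: r => [|k r IH].
  rewrite big_nil -[RHS](nabla0r oU Up SX); congr (nabla _ _ _).
  by apply/funext => q; rewrite big_nil.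
rewrite big_cons -IH -(nablaDr oU Up SX (SY k) (smooth_vfield_sum _ oU SY)).
by congr (nabla _ _ _); apply/funext => q; rewrite big_cons.
Qed.

Lemma nabla_congr_r U X Y Y' p : open U -> U p -> smooth_vfield_on A U X ->
  smooth_vfield_on A U Y -> (forall q, U q -> Y q = Y' q) ->
  nabla X Y p = nabla X Y' p.
Proof.
move=> oU Up SX SY YY'; have SY' := smooth_vfield_congr oU YY' SY.
apply/eqP; rewrite -subr_eq0 -(nablaBr oU Up SX SY SY').
rewrite (nabla_vanish_r oU Up SX (smooth_vfieldB oU SY SY')) //.
by move=> q Uq; rewrite YY' // subrr.
Qed.

(** The extension of [v] with constant components in the preferred chart of [p];
    with it, identities between smooth fields give identities between tangent
    vectors. *)
Definition extend (p : M) (v : 'rV[R]_n) : vfield R n M :=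
  fun q => \sum_k v 0 k *: coord_vfield (chart_at A p) k q.

Lemma extend_smooth p v : smooth_vfield_on A (dom (chart_at A p)) (extend p v).
Proof.
have o := open_dom (A := A) (chart_at A p).
apply: smooth_vfield_sum => // k.
exact: smooth_vfieldZ o (smooth_on_cst _ o) (coord_vfield_smooth _ _).
Qed.

Lemma extend_at p v : extend p v p = v.
Proof.
rewrite /extend [RHS]row_sum_delta.
by apply: eq_bigr => k _; rewrite coord_vfield_at.
Qed.

End Connection.

(** * The metric and its curvature tensor *)

Section Metric.
Context (R : realType) (n : nat) (M : topologicalType).
Context (A : smooth_manifold R n M) (g : M -> 'M[R]_n).
Context (hg : riemannian_metric A g).
Implicit Types (p : M) (u v w : 'rV[R]_n).

Definition inner_at p v w : R := (v *m g p *m w^T) 0 0.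
Local Notation ip := inner_at.

Lemma innerE (X Y : vfield R n M) p : inner g X Y p = ip p (X p) (Y p).
Proof. by []. Qed.

Lemma ipDl p u v w : ip p (u + v) w = ip p u w + ip p v w.
Proof. by rewrite /inner_at !mulmxDl mxE. Qed.
Lemma ipZl p (a : R) v w : ip p (a *: v) w = a * ip p v w.
Proof. by rewrite /inner_at -!scalemxAl mxE. Qed.
Lemma ipNl p v w : ip p (- v) w = - ip p v w.
Proof. by rewrite -scaleN1r ipZl mulN1r. Qed.
Lemma ipBl p u v w : ip p (u - v) w = ip p u w - ip p v w.
Proof. by rewrite ipDl ipNl. Qed.
Lemma ip0l p w : ip p 0 w = 0.
Proof. by rewrite /inner_at !mul0mx mxE. Qed.

Lemma ipC p v w : ip p v w = ip p w v.
Proof.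
rewrite /inner_at; have -> : v *m g p *m w^T = (w *m g p *m v^T)^T.
  by rewrite !trmx_mul trmxK (Defs.metric_sym hg) mulmxA.
by rewrite mxE.
Qed.

Lemma ipDr p u v w : ip p w (u + v) = ip p w u + ip p w v.
Proof. by rewrite ![ip p w _]ipC ipDl. Qed.
Lemma ipZr p (a : R) v w : ip p w (a *: v) = a * ip p w v.
Proof. by rewrite ![ip p w _]ipC ipZl. Qed.
Lemma ipNr p v w : ip p w (- v) = - ip p w v.
Proof. by rewrite ![ip p w _]ipC ipNl. Qed.
Lemma ipBr p u v w : ip p w (u - v) = ip p w u - ip p w v.
Proof. by rewrite ipDr ipNr. Qed.
Lemma ip0r p w : ip p w 0 = 0.
Proof. by rewrite ipC ip0l. Qed.

Lemma ip_ge0 p v : 0 <= ip p v v.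
Proof. by have [->|/(metric_pos hg p)/ltW//] := eqVneq v 0; rewrite ip0l. Qed.

Lemma ip_eq0 p v : ip p v v = 0 -> v = 0.
Proof.
by move=> v0; apply/eqP/negPn/negP => /(metric_pos hg p); rewrite [ltRHS]v0 ltxx.
Qed.

Lemma ip_inj p v w : (forall u, ip p v u = ip p w u) -> v = w.
Proof.
by move=> vw; apply/eqP; rewrite -subr_eq0; apply/eqP/(@ip_eq0 p); rewrite ipBl vw subrr.
Qed.

End Metric.

Section LeviCivita.
Context (R : realType) (n : nat) (M : topologicalType).
Context (A : smooth_manifold R n M) (g : M -> 'M[R]_n).
Context (nabla : vfield R n M -> vfield R n M -> vfield R n M).
Local Notation ip := inner_at.
Context (hg : riemannian_metric A g) (hLC : levi_civita A g nabla).
Implicit Types (U : set M) (p q : M) (X Y Z W : vfield R n M).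

Let hn : affine_connection A nabla := levi_civita_connection hLC.

Lemma nabla_smooth U X Y : open U -> smooth_vfield_on A U X ->
  smooth_vfield_on A U Y -> smooth_vfield_on A U (nabla X Y).
Proof. by move=> oU SX SY; exact: (connection_smooth hn oU SX SY). Qed.

Lemma bracketE U X Y p : open U -> U p -> smooth_vfield_on A U X ->
  smooth_vfield_on A U Y -> bracket A X Y p = nabla X Y p - nabla Y X p.
Proof. by move=> oU Up SX SY; rewrite (levi_civita_torsion_free hLC oU SX SY Up). Qed.

Lemma bracket_smooth U X Y : open U -> smooth_vfield_on A U X ->
  smooth_vfield_on A U Y -> smooth_vfield_on A U (bracket A X Y).
Proof.
move=> oU SX SY.
have S := smooth_vfieldB oU (nabla_smooth oU SX SY) (nabla_smooth oU SY SX).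
by apply: smooth_vfield_congr S => // q Uq; rewrite (bracketE oU Uq).
Qed.

Lemma vder_inner U X Y Z p : open U -> U p -> smooth_vfield_on A U X ->
  smooth_vfield_on A U Y -> smooth_vfield_on A U Z ->
  vder A Z (inner g X Y) p = ip g p (nabla Z X p) (Y p) + ip g p (X p) (nabla Z Y p).
Proof. by move=> oU Up SX SY SZ; exact: (levi_civita_metric hLC oU SX SY SZ Up). Qed.

Lemma vder_vder_inner U X Y Z W p : open U -> U p -> smooth_vfield_on A U X ->
  smooth_vfield_on A U Y -> smooth_vfield_on A U Z -> smooth_vfield_on A U W ->
  vder A X (vder A Y (inner g Z W)) p
  = ip g p (nabla X (nabla Y Z) p) (W p) + ip g p (nabla Y Z p) (nabla X W p)
    + (ip g p (nabla X Z p) (nabla Y W p) + ip g p (Z p) (nabla X (nabla Y W) p)).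
Proof.
move=> oU Up SX SY SZ SW.
have SYZ := nabla_smooth oU SY SZ; have SYW := nabla_smooth oU SY SW.
have S1 := metric_smooth hg oU SYZ SW; have S2 := metric_smooth hg oU SZ SYW.
rewrite -(vder_inner oU Up SYZ SW SX) -(vder_inner oU Up SZ SYW SX).
rewrite -(vder_fctD _ oU S1 S2 Up); symmetry.
apply: (vder_congr _ oU (smooth_onD oU S1 S2)) => // q Uq.
by rewrite (vder_inner oU Uq SZ SW SY).
Qed.

(** For [f = g(Z,W)], both sides of [X(Y(f)) - Y(X(f)) = [X,Y](f)] are expanded
    by compatibility with the metric; the terms with one derivative on each
    of [Z] and [W] cancel. *)
Lemma riemann_skew U X Y Z W p : open U -> U p -> smooth_vfield_on A U X ->
  smooth_vfield_on A U Y -> smooth_vfield_on A U Z -> smooth_vfield_on A U W ->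
  ip g p (riemann A nabla X Y Z p) (W p) = - ip g p (Z p) (riemann A nabla X Y W p).
Proof.
move=> oU Up SX SY SZ SW; have SB := bracket_smooth oU SX SY.
have := vder_bracket oU SX SY (metric_smooth hg oU SZ SW) Up.
rewrite (vder_inner oU Up SZ SW SB) (vder_vder_inner oU Up SX SY SZ SW).
rewrite (vder_vder_inner oU Up SY SX SZ SW).
rewrite /riemann !(ipBl, ipBr hg); lra.
Qed.

End LeviCivita.

(** * Closed affine conformal fields *)

Section Soliton.
Context (R : realType) (n : nat) (M : topologicalType).
Context (A : smooth_manifold R n M) (g : M -> 'M[R]_n).
Context (nabla : vfield R n M -> vfield R n M -> vfield R n M).
Context (xi : vfield R n M) (lambda rho : M -> R) (H : M -> 'M[R]_n).
Context (hg : riemannian_metric A g) (hLC : levi_civita A g nabla).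
Context (hxi : smooth_vfield A xi) (hclosed : closed_vfield A g xi).
Context (hrho : smooth A rho).
Context (hH : is_H_tensor A g xi rho H).
Implicit Types (U : set M) (p q : M) (X Y Z W : vfield R n M).

Local Notation x_ := (chart_map A).
Local Notation dom := (chart_dom A).
Local Notation Rm := (riemann A nabla).
Local Notation ip := (inner_at g).
Local Notation "'HH' X" := (fun q => X q *m H q) (at level 10, X at level 9).

Let hn : affine_connection A nabla := levi_civita_connection hLC.

Lemma xi_smooth U : smooth_vfield_on A U xi.
Proof. by apply: smooth_vfield_subset hxi. Qed.

Lemma rho_smooth U : smooth_on A U rho.
Proof. by apply: smooth_on_subset hrho. Qed.

(** Compatibility with the metric and vanishing torsion turn [d(xi^b) = 0] into
    the symmetry of [nabla xi]. *)
Lemma nabla_xi_sym U X Y p : open U -> U p -> smooth_vfield_on A U X ->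
  smooth_vfield_on A U Y -> ip p (nabla X xi p) (Y p) = ip p (X p) (nabla Y xi p).
Proof.
move=> oU Up SX SY; have Sx := @xi_smooth U.
have := hclosed oU SX SY Up.
rewrite (vder_inner hLC oU Up Sx SY SX) (vder_inner hLC oU Up Sx SX SY).
rewrite innerE (bracketE hLC oU Up SX SY) (ipBr hg) (ipC hg p (X p) (nabla Y xi p)).
lra.
Qed.

Lemma lie_metricE U X Y p : open U -> U p -> smooth_vfield_on A U X ->
  smooth_vfield_on A U Y -> lie_metric A g xi X Y p = 2 * ip p (nabla X xi p) (Y p).
Proof.
move=> oU Up SX SY; have Sx := @xi_smooth U.
rewrite /lie_metric (vder_inner hLC oU Up SX SY Sx) !innerE.
rewrite (bracketE hLC oU Up Sx SX) (bracketE hLC oU Up Sx SY).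
rewrite (ipBl) (ipBr hg) (nabla_xi_sym oU Up SX SY); lra.
Qed.

(** For a closed field [L_xi g = 2 g(nabla xi, .)], and the definition of [H]
    reads [L_xi g = 2 rho g + g(H ., .)]. *)
Lemma nabla_xi U X p : open U -> U p -> smooth_vfield_on A U X ->
  nabla X xi p = rho p *: X p + 2^-1 *: (X p *m H p).
Proof.
move=> oU Up SX; apply: (ip_inj hg (p := p)) => u.
have oU' := openI oU (open_dom (A := A) (chart_at A p)).
have Up' : (U `&` dom (chart_at A p)) p by split=> //; exact: chart_atP.
have SX' : smooth_vfield_on A (U `&` dom (chart_at A p)) X.
  by apply: smooth_vfield_subset SX => q [].
have SY : smooth_vfield_on A (U `&` dom (chart_at A p)) (extend A p u).
  by apply: smooth_vfield_subset (@extend_smooth _ _ _ A p u) => q [].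
have := hH oU' SX' SY Up'; rewrite (lie_metricE oU' Up' SX' SY) !innerE extend_at.
by rewrite ipDl !ipZl => ->; field.
Qed.

(** [H] is only given pointwise; it is smooth because [H X] equals
    [2 (nabla_X xi - rho X)]. *)
Lemma H_smooth U X : open U -> smooth_vfield_on A U X ->
  smooth_vfield_on A U (HH X).
Proof.
move=> oU SX; have Sx := @xi_smooth U.
have S := smooth_vfieldZ oU (smooth_on_cst 2 oU) (smooth_vfieldB oU
  (nabla_smooth hLC oU SX Sx) (smooth_vfieldZ oU (@rho_smooth U) SX)).
apply: smooth_vfield_congr S => // q Uq.
by rewrite (nabla_xi oU Uq SX) addrAC subrr add0r scalerA mulfV ?scale1r.
Qed.

Lemma H_sym p u v : ip p (u *m H p) v = ip p u (v *m H p).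
Proof.
have o := open_dom (A := A) (chart_at A p); have cp := chart_atP A p.
have Su := @extend_smooth _ _ _ A p u; have Sv := @extend_smooth _ _ _ A p v.
have := nabla_xi_sym o cp Su Sv.
rewrite (nabla_xi o cp Su) (nabla_xi o cp Sv) !extend_at.
rewrite ipDl !ipZl (ipDr hg) !(ipZr hg); lra.
Qed.

Section AffineConformal.
Context (G : vfield R n M) (hG : is_gradient A g rho G).
Context (hL : for_all_vfields2 A (fun X Y p =>
    lie_connection A nabla xi X Y p
    = vder A X rho p *: Y p + vder A Y rho p *: X p - inner g X Y p *: G p)).

Lemma nabla_nabla_xi U X Y p : open U -> U p -> smooth_vfield_on A U X ->
  smooth_vfield_on A U Y -> nabla X (nabla Y xi) p
  = vder A X rho p *: Y p + rho p *: nabla X Y p + 2^-1 *: nabla X (HH Y) p.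
Proof.
move=> oU Up SX SY; have SHY := H_smooth oU SY.
have Sr := @rho_smooth U.
have SrY := smooth_vfieldZ oU Sr SY.
have ShHY := smooth_vfieldZ oU (smooth_on_cst (2^-1) oU) SHY.
rewrite (nabla_congr_r hn oU Up SX (nabla_smooth hLC oU SY (@xi_smooth U))
  (fun q Uq => nabla_xi oU Uq SY)).
rewrite (nablaDr hn oU Up SX SrY ShHY) (nablaZcr hn _ oU Up SX SHY).
by rewrite (connection_leibniz hn oU Sr SX SY Up).
Qed.

(** This is [(nabla_X H)(Y)]. *)
Definition nablaH X Y : vfield R n M := fun p =>
  nabla X (HH Y) p - nabla X Y p *m H p.

Lemma nablaH_sym U X Y Z p : open U -> U p -> smooth_vfield_on A U X ->
  smooth_vfield_on A U Y -> smooth_vfield_on A U Z ->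
  ip p (nablaH X Y p) (Z p) = ip p (nablaH X Z p) (Y p).
Proof.
move=> oU Up SX SY SZ.
have SHY := H_smooth oU SY; have SHZ := H_smooth oU SZ.
have E1 := vder_inner hLC oU Up SHY SZ SX.
have E2 := vder_inner hLC oU Up SY SHZ SX.
have E : inner g (HH Y) Z = inner g Y (HH Z).
  by apply/funext => q; rewrite !innerE H_sym.
rewrite E E2 /= in E1.
rewrite /nablaH !ipBl !H_sym [in RHS](ipC hg) [in X in _ = _ - X](ipC hg).
lra.
Qed.

(** Writing brackets as [nabla_X Y - nabla_Y X] gives
    [(L_xi nabla)(X,Y) = R(xi,X)Y + nabla_X nabla_Y xi - nabla_(nabla_X Y) xi]. *)
Lemma lie_connectionE U X Y p : open U -> U p -> smooth_vfield_on A U X ->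
  smooth_vfield_on A U Y -> lie_connection A nabla xi X Y p
  = Rm xi X Y p + vder A X rho p *: Y p + 2^-1 *: nablaH X Y p.
Proof.
move=> oU Up SX SY; have Sx := @xi_smooth U.
have SXY := nabla_smooth hLC oU SX SY.
have SxY := nabla_smooth hLC oU Sx SY; have SYx := nabla_smooth hLC oU SY Sx.
rewrite /lie_connection (bracketE hLC oU Up Sx SXY).
rewrite (nabla_congr_r hn oU Up SX (bracket_smooth hLC oU Sx SY)
  (fun q Uq => bracketE hLC oU Uq Sx SY)) (nablaBr hn oU Up SX SxY SYx).
rewrite (nabla_nabla_xi oU Up SX SY) (nabla_xi oU Up SXY) /riemann /nablaH.
by apply/rowP => k; rewrite !mxE; ring.
Qed.

(** The affine conformal equation now reads
    [R(xi,X)Y + (nabla_X H)(Y)/2 = Y(rho) X - g(X,Y) grad rho]. Its right-hand side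
    and [R(xi,X)] are skew-adjoint in [Y], whereas [nabla_X H] is self-adjoint;
    so [H] is parallel. *)
Lemma H_parallel U X Y p : open U -> U p -> smooth_vfield_on A U X ->
  smooth_vfield_on A U Y -> nabla X (HH Y) p = nabla X Y p *m H p.
Proof.
move=> oU Up SX SY; apply/eqP; rewrite -subr_eq0; apply/eqP.
rewrite -/(nablaH X Y p); apply: (ip_inj hg (p := p)) => u; rewrite ip0l.
pose U' := U `&` dom (chart_at A p).
have oU' : open U' := openI oU (open_dom (A := A) (chart_at A p)).
have Up' : U' p by split=> //; exact: chart_atP.
have {}SX : smooth_vfield_on A U' X by apply: smooth_vfield_subset SX => q [].
have {}SY : smooth_vfield_on A U' Y by apply: smooth_vfield_subset SY => q [].
have SZ : smooth_vfield_on A U' (extend A p u).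
  by apply: smooth_vfield_subset (@extend_smooth _ _ _ A p u) => q [].
rewrite -[u](@extend_at _ _ _ A p); set Z := extend A p u in SZ *.
have Sx := @xi_smooth U'.
have E V : smooth_vfield_on A U' V -> 2^-1 *: nablaH X V p =
    vder A V rho p *: X p - inner g X V p *: G p - Rm xi X V p.
  move=> SV; have := hL oU' SX SV Up'; rewrite (lie_connectionE oU' Up' SX SV).
  by move=> /rowP e; apply/rowP => k; have := e k; rewrite !mxE; lra.
have gradE V : ip p (G p) (V p) = vder A V rho p by exact: hG.
have e1 : ip p (2^-1 *: nablaH X Y p) (Z p) = _ := congr1 (fun w => ip p w (Z p)) (E Y SY).
have e2 : ip p (2^-1 *: nablaH X Z p) (Y p) = _ := congr1 (fun w => ip p w (Y p)) (E Z SZ).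
have S0 := nablaH_sym oU' Up' SX SZ SY.
have K0 := riemann_skew hg hLC oU' Up' Sx SX SY SZ.
move: e1 e2 S0 K0; rewrite !innerE.
move: (nablaH X Y p) (nablaH X Z p) (Rm xi X Y p) (Rm xi X Z p) => a b r s.
rewrite !ipZl !ipBl !ipZl !gradE (ipC hg p s); lra.
Qed.

(** As [H] is parallel, only the derivative of [rho] survives when
    [nabla xi = rho + H/2] is differentiated again. *)
Lemma riemann_xi U X Y p : open U -> U p -> smooth_vfield_on A U X ->
  smooth_vfield_on A U Y ->
  Rm X Y xi p = vder A X rho p *: Y p - vder A Y rho p *: X p.
Proof.
move=> oU Up SX SY; have SB := bracket_smooth hLC oU SX SY.
rewrite /riemann (nabla_nabla_xi oU Up SX SY) (nabla_nabla_xi oU Up SY SX).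
rewrite (nabla_xi oU Up SB) (H_parallel oU Up SX SY) (H_parallel oU Up SY SX).
rewrite (bracketE hLC oU Up SX SY) mulmxBl.
by apply/rowP => k; rewrite !mxE; ring.
Qed.

Lemma riemann_H U X Y Z p : open U -> U p -> smooth_vfield_on A U X ->
  smooth_vfield_on A U Y -> smooth_vfield_on A U Z ->
  Rm X Y (HH Z) p = Rm X Y Z p *m H p.
Proof.
move=> oU Up SX SY SZ; have SB := bracket_smooth hLC oU SX SY.
have SHZ := H_smooth oU SZ.
have P V W : smooth_vfield_on A U V -> smooth_vfield_on A U W ->
    nabla V (nabla W (HH Z)) p = nabla V (nabla W Z) p *m H p.
  move=> SV SW; have SWZ := nabla_smooth hLC oU SW SZ.
  rewrite (nabla_congr_r hn oU Up SV (nabla_smooth hLC oU SW SHZ)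
    (fun q Uq => H_parallel oU Uq SW SZ)).
  exact: H_parallel oU Up SV SWZ.
by rewrite /riemann !P // (H_parallel oU Up SB SZ) !mulmxBl.
Qed.


Context (n_gt0 : (0 < n)%N) (htr : forall p, \tr (H p) = 0).
Context (hR : for_all_vfields2 A (fun X Y p =>
  2^-1 * lie_metric A g xi X Y p + ricci A nabla X Y p
  = lambda p * inner g X Y p)).

Lemma ricciE U Y Z p : open U -> U p -> smooth_vfield_on A U Y ->
  smooth_vfield_on A U Z -> ricci A nabla Y Z p
  = (lambda p - rho p) * ip p (Y p) (Z p) - 2^-1 * ip p (Y p *m H p) (Z p).
Proof.
move=> oU Up SY SZ; have := hR oU SY SZ Up.
rewrite (lie_metricE oU Up SY SZ) (nabla_xi oU Up SY) innerE ipDl !ipZl; lra.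
Qed.

Lemma tdiff_rho_sum p (v : 'rV[R]_n) :
  tdiff A rho p v = \sum_i tdiff A rho p (delta_mx 0 i) * v 0 i.
Proof.
rewrite {1}[v]row_sum_delta tdiff_sum; apply: eq_bigr => i _.
by rewrite tdiffZ; exact: mulrC.
Qed.

(** The trace of [X |-> X(rho) Y - Y(rho) X]. *)
Lemma ricci_xi U Y p : open U -> U p -> smooth_vfield_on A U Y ->
  ricci A nabla Y xi p = (1 - n%:R) * vder A Y rho p.
Proof.
move=> oU Up SY; pose c := chart_at A p; pose U' := U `&` dom c.
have oU' : open U' := openI oU (open_dom (A := A) c).
have Up' : U' p by split=> //; exact: chart_atP.
have {}SY : smooth_vfield_on A U' Y by apply: smooth_vfield_subset SY => q [].
have SE i : smooth_vfield_on A U' (coord_vfield c i).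
  by apply: smooth_vfield_subset (@coord_vfield_smooth _ _ _ A c i) => q [].
rewrite /ricci /mxtrace.
transitivity (\sum_i (tdiff A rho p (delta_mx 0 i) * Y p 0 i - vder A Y rho p)).
  apply: eq_bigr => i _; rewrite mxE (riemann_xi oU' Up' (SE i) SY) !mxE.
  by rewrite /vder coord_vfield_at mxE !eqxx mulr1.
rewrite sumrB -tdiff_rho_sum sumr_const card_ord mulrBl mul1r.
by rewrite mulr_natl.
Qed.

(** The trace of [X |-> X(rho) HY - Y(rho) HX], where [tr H = 0] removes the second
    term. *)
Lemma ricci_Hxi U Y p : open U -> U p -> smooth_vfield_on A U Y ->
  ricci A nabla Y (HH xi) p = tdiff A rho p (Y p *m H p).
Proof.
move=> oU Up SY; pose c := chart_at A p; pose U' := U `&` dom c.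
have oU' : open U' := openI oU (open_dom (A := A) c).
have Up' : U' p by split=> //; exact: chart_atP.
have {}SY : smooth_vfield_on A U' Y by apply: smooth_vfield_subset SY => q [].
have SE i : smooth_vfield_on A U' (coord_vfield c i).
  by apply: smooth_vfield_subset (@coord_vfield_smooth _ _ _ A c i) => q [].
rewrite /ricci {1}/mxtrace.
transitivity (\sum_i (tdiff A rho p (delta_mx 0 i) * (Y p *m H p) 0 i
    - vder A Y rho p * H p i i)).
  apply: eq_bigr => i _; rewrite mxE.
  rewrite (riemann_H oU' Up' (SE i) SY (@xi_smooth U')).
  rewrite (riemann_xi oU' Up' (SE i) SY) mulmxBl -!scalemxAl.
  have entry (a b : R) (u w : 'rV[R]_n) :
      (a *: u - b *: w) 0 i = a * u 0 i - b * w 0 i by rewrite !mxE.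
  by rewrite entry /vder coord_vfield_at -rowE [row i (H p) 0 i]mxE.
by rewrite sumrB -tdiff_rho_sum -mulr_sumr -/(\tr (H p)) htr mulr0 subr0.
Qed.

(** By the soliton equation the Ricci operator is [lambda - rho - H/2], which
    commutes with [H]; so [Ric(Y, H xi) = Ric(HY, xi)]. The left-hand side is
    [(HY)(rho)] and the right-hand side [(1 - n) (HY)(rho)], hence
    [n (HY)(rho) = 0]. *)
Lemma drho_H_eq0 p (v : 'rV[R]_n) : tdiff A rho p (v *m H p) = 0.
Proof.
have o := open_dom (A := A) (chart_at A p); have cp := chart_atP A p.
have Sv := @extend_smooth _ _ _ A p v.
have SHv := H_smooth o Sv.
have Sx := @xi_smooth (dom (chart_at A p)); have SHx := H_smooth o Sx.
have := ricci_Hxi o cp Sv; have := ricci_xi o cp SHv.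
rewrite (ricciE o cp Sv SHx) (ricciE o cp SHv Sx) /vder extend_at -!H_sym => ->.
move=> E; have : n%:R * tdiff A rho p (v *m H p) = 0 by move: E; lra.
move/eqP; rewrite mulf_eq0 pnatr_eq0 => /orP[|/eqP//].
by rewrite eqn0Ngt n_gt0.
Qed.

(** For [Y = H xi], the skewness relation
    [g(R(X,Y) xi, H xi) = - g(xi, R(X,Y) H xi)] becomes
    [X(rho) |H xi|^2 = 0], because [(H xi)(rho) = 0]. *)
Lemma drho_Hxi_eq0 p (v : 'rV[R]_n) :
  tdiff A rho p v * ip p (xi p *m H p) (xi p *m H p) = 0.
Proof.
have o := open_dom (A := A) (chart_at A p); have cp := chart_atP A p.
have Sx := @xi_smooth (dom (chart_at A p)); have SHx := H_smooth o Sx.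
have SX := @extend_smooth _ _ _ A p v.
have := riemann_skew hg hLC o cp SX SHx Sx SHx.
rewrite (riemann_H o cp SX SHx Sx) (riemann_xi o cp SX SHx) /vder extend_at drho_H_eq0.
rewrite !scale0r !subr0 -scalemxAl ipZl (ipZr hg) (ipC hg p (xi p)) !H_sym.
lra.
Qed.

(** If [d rho] does not vanish at [p], it does not nearby, where then [H xi = 0].
    Differentiating this gives [H (rho + H/2) = 0] at [p], and [tr H = 0]. *)
Lemma trace_H2_of_drho_neq0 p (v : 'rV[R]_n) : tdiff A rho p v != 0 ->
  \tr (H p *m H p) = 0.
Proof.
move=> rv; pose c := chart_at A p; have cp : dom c p := chart_atP A p.
(* A coordinate direction is needed, so that [d_k rho] is a continuous function
   around [p]. *)
have [k rk] : exists k, tdiff A rho p (delta_mx 0 k) != 0.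
  apply/existsP; apply: contraR rv; rewrite negb_exists => /forallP r0.
  rewrite tdiff_rho_sum big1 // => k _.
  by have := r0 k; rewrite negbK => /eqP ->; rewrite mul0r.
have Sr := @rho_smooth setT.
pose F := fun z => 'D_(delta_mx 0 k) (rho \o chart_inv A c) z.
have cF : {for x_ c p, continuous F}.
  apply: differentiable_continuous.
  by have [_ /(_ (delta_mx 0 k))[d _]] := Sr c 2; apply: d; exists p.
have FE q : dom c q -> F (x_ c q) = vder A (coord_vfield c k) rho q.
  by move=> cq; rewrite (vder_coord_vfield _ Sr I cq).
have F0 : F (x_ c p) != 0 by rewrite FE // /vder coord_vfield_at.
have nF : \forall q \near p, F (x_ c q) != 0.
  apply: (near_chart_map (Q := fun z => F z != 0) cp).
  exact: (cvgr_neq0 (F (x_ c p)) cF F0).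
pose U := (fun q => F (x_ c q) != 0)° `&` dom c.
have oU : open U by apply: openI; [exact: open_interior|exact: open_dom].
have Up : U p by [].
have Hxi0 q : U q -> xi q *m H q = 0.
  move=> [/interior_subset Fq cq]; apply: (ip_eq0 hg (p := q)).
  have := drho_Hxi_eq0 q (coord_vfield c k q); rewrite -/(vder A _ rho q) -FE //.
  by move/eqP; rewrite mulf_eq0 (negbTE Fq) => /eqP.
have HB (u : 'rV[R]_n) : (rho p *: u + 2^-1 *: (u *m H p)) *m H p = 0.
  have SX : smooth_vfield_on A U (extend A p u).
    by apply: smooth_vfield_subset (@extend_smooth _ _ _ A p u) => q [].
  have Sx := @xi_smooth U.
  have := nabla_xi oU Up SX; rewrite extend_at => <-.
  rewrite -(H_parallel oU Up SX Sx).
  exact: (nabla_vanish_r hn oU Up SX (H_smooth oU Sx)).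
have E : rho p *: H p + 2^-1 *: (H p *m H p) = 0.
  apply/row_matrixP => i; rewrite row0 -[RHS](HB (delta_mx 0 i)).
  by rewrite mulmxDl -!scalemxAl -!rowE linearD !linearZ /= row_mul.
have := congr1 mxtrace E; rewrite mxtraceD !mxtraceZ htr mulr0 add0r mxtrace0.
by move/eqP; rewrite mulf_eq0 invr_eq0 pnatr_eq0 => /eqP.
Qed.


(** Let [p] be a maximum of [f = |xi|^2] with [d rho = 0] at [p], the other case
    being settled. Put [B = nabla xi = rho + H/2] and [W = nabla_xi xi = B xi]; then
    [X(f) = 2 g(X,W)], so [W] vanishes at [p], and
    [X(X(f)) = 2 g(X, B^2 X) = 2 |BX|^2] there. The second derivative test gives
    [B = 0] at [p]; taking traces, [rho = 0] and then [H = 0]. *)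
Lemma trace_H2_at_max p : (forall q, inner g xi xi q <= inner g xi xi p) ->
  \tr (H p *m H p) = 0.
Proof.
move=> fmax.
have [[v rv]|r0] := pselect (exists v, tdiff A rho p v != 0).
  exact: trace_H2_of_drho_neq0 rv.
have {}r0 v : tdiff A rho p v = 0.
  by apply/eqP/negPn/negP => rv; apply: r0; exists v.
pose c := chart_at A p; have cp : dom c p := chart_atP A p.
have o := open_dom (A := A) c; have Sx := @xi_smooth (dom c).
pose f := inner g xi xi.
have Sf : smooth_on A setT f.
  by apply: (metric_smooth hg openT); exact: xi_smooth.
have Sfc : smooth_on A (dom c) f by exact: smooth_on_subset Sf.
pose F := f \o chart_inv A c.
have Fmax : \forall z \near x_ c p, F z <= F (x_ c p).
  apply: filterS (chart_image_open_nbhs openT I cp) => z _.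
  by rewrite /F /= chart_mapK.
have Ftest v := second_derive_at_max v (open_chart_image (i := c) openT)
  (mem_chart_image I cp) (Sf c 3) Fmax.
pose W := nabla xi xi.
have SW : smooth_vfield_on A (dom c) W by exact: (nabla_smooth hLC o Sx Sx).
have df X q : dom c q -> smooth_vfield_on A (dom c) X ->
    vder A X f q = 2 * inner g X W q.
  move=> cq SX; rewrite (vder_inner hLC o cq Sx Sx SX) (ipC hg q (xi q)) innerE.
  by rewrite (nabla_xi_sym o cq SX Sx) mulrDl !mul1r.
have W0 : W p = 0.
  apply: (ip_inj hg (p := p)) => u; rewrite ip0l (ipC hg).
  have SX := @extend_smooth _ _ _ A p u; have := df _ p cp SX.
  rewrite (vder_derive _ Sf I) innerE extend_at; have [-> _] := Ftest u.
  by move/esym/eqP; rewrite mulf_eq0 pnatr_eq0 => /eqP.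
have B0 k : rho p *: delta_mx 0 k + 2^-1 *: (delta_mx 0 k *m H p) = 0 :> 'rV[R]_n.
  pose X := coord_vfield c k.
  have SX : smooth_vfield_on A (dom c) X by exact: coord_vfield_smooth.
  have Xp : X p = delta_mx 0 k by exact: coord_vfield_at.
  have E1 : vder A X (vder A X f) p = 2 * ip p (X p) (nabla X W p).
    have SXW := metric_smooth hg o SX SW.
    have SXW2 := smooth_onM o (smooth_on_cst (A := A) 2 o) SXW.
    rewrite -(vder_congr X o SXW2 (fun q cq => esym (df X q cq SX)) cp).
    rewrite (vder_fctM X o (smooth_on_cst (A := A) 2 o) SXW cp) vder_cst mulr0 addr0.
    by rewrite (vder_inner hLC o cp SX SW SX) W0 (ip0r hg) add0r.
  have E2 : vder A X (vder A X f) p <= 0.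
    rewrite (vder_vder X o SX Sfc cp) (bigD1 k) //= big1 => [|j jk].
      rewrite Xp mxE !eqxx mul1r addr0; have [-> D2] := Ftest (delta_mx 0 k).
      by rewrite mul0r addr0.
    have [-> _] := Ftest (delta_mx 0 j).
    by rewrite Xp mxE eqxx (negbTE jk) !mul0r addr0.
  pose b : 'rV[R]_n := rho p *: X p + 2^-1 *: (X p *m H p).
  have E3 : nabla X W p = rho p *: b + 2^-1 *: (b *m H p).
    rewrite (nabla_nabla_xi o cp SX Sx) (H_parallel o cp SX Sx).
    by rewrite (nabla_xi o cp SX) {1}/vder r0 scale0r add0r.
  rewrite -Xp -/b; apply: (ip_eq0 hg (p := p)).
  apply/eqP; rewrite eq_le (ip_ge0 hg) andbT.
  have B_sym w :
      ip p b w = ip p (X p) (rho p *: w + 2^-1 *: (w *m H p)).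
    by rewrite /b ipDl !ipZl (ipDr hg) !(ipZr hg) H_sym.
  rewrite B_sym -E3.
  by rewrite -(pmulr_rle0 _ (ltr0Sn R 1)) -E1.
have E : (rho p)%:M + 2^-1 *: H p = 0.
  apply/row_matrixP => i; rewrite row0 -[RHS](B0 i).
  by rewrite linearD linearZ /= !rowE mul_mx_scalar.
have rho0 : rho p = 0.
  have := congr1 mxtrace E; rewrite mxtraceD mxtraceZ htr mulr0 addr0 mxtrace0.
  rewrite mxtrace_scalar => /eqP; rewrite mulrn_eq0 => /orP[|/eqP//].
  by rewrite eqn0Ngt n_gt0.
move: E; rewrite rho0 raddf0 add0r => /eqP.
rewrite scaler_eq0 invr_eq0 pnatr_eq0 => /eqP ->.
by rewrite mulmx0 mxtrace0.
Qed.

(** In the coordinate frame [E] of a chart, [H] has a smooth matrix [N], and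
    [nabla_X (H E_k) = H (nabla_X E_k)] becomes [X(N) = Gam N - N Gam], with [Gam]
    the matrix of [nabla_X E]. Hence [X(tr(N^2)) = 2 tr(N (Gam N - N Gam)) = 0]. *)
Lemma trace_H2_locally_constant p :
  \forall q \near p, \tr (H q *m H q) = \tr (H p *m H p).
Proof.
pose i := chart_at A p; have ip_ : dom i p := chart_atP A p.
have o := open_dom (A := A) i.
pose E k := coord_vfield i k.
have SE k : smooth_vfield_on A (dom i) (E k) by exact: coord_vfield_smooth.
pose P q : 'M[R]_n := \matrix_k E k q.
pose Q q : 'M[R]_n := \matrix_k tdiff A (x_ i) q (delta_mx 0 k).
pose N q : 'M[R]_n := \matrix_k tdiff A (x_ i) q (E k q *m H q).
have expand q (v : 'rV[R]_n) : dom i q -> v = tdiff A (x_ i) q v *m P q.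
  move=> iq; rewrite [LHS](frame_expansion v iq) mulmx_sum_row.
  by apply: eq_bigr => k _; rewrite rowK.
have QP q : dom i q -> Q q *m P q = 1%:M.
  move=> iq; apply/row_matrixP => k; rewrite row_mul rowK -expand //.
  by rewrite rowE mulmx1.
have PHN q : dom i q -> P q *m H q = N q *m P q.
  by move=> iq; apply/row_matrixP => k; rewrite !row_mul !rowK -expand.
have trN q : dom i q -> \tr (H q *m H q) = \tr (N q *m N q).
  by move=> iq; exact: trace_sqr_conj (QP q iq) (PHN q iq).
have SN k l : smooth_on A (dom i) (fun q => N q k l).
  have := H_smooth o (SE k) i l; rewrite setIid.
  by apply: smooth_on_congr => // q iq; rewrite mxE.
pose t q := \sum_k \sum_l N q k l * N q l k.
have St : smooth_on A (dom i) t.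
  by apply: smooth_on_sum => // k; apply: smooth_on_sum => // l; exact: smooth_onM.
have tE q : dom i q -> \tr (H q *m H q) = t q.
  move=> iq; rewrite trN //; apply: eq_bigr => k _; rewrite mxE.
  exact: eq_bigr.
have dt q m : dom i q -> vder A (E m) t q = 0.
  move=> iq; pose X := E m; have SX : smooth_vfield_on A (dom i) X by exact: SE.
  pose N' : 'M[R]_n := \matrix_(k, l) vder A X (fun q => N q k l) q.
  pose Gam : 'M[R]_n := \matrix_k tdiff A (x_ i) q (nabla X (E k) q).
  have N'E : N' = Gam *m N q - N q *m Gam.
    suff e : (N' + N q *m Gam) *m P q = Gam *m N q *m P q.
      apply: (canRL (addrK _)); move/(congr1 (mulmx^~ (Q q))): e.
      by rewrite -!mulmxA (mulmx1C (QP q iq)) !mulmx1.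
    rewrite -mulmxA -PHN // mulmxA; apply/row_matrixP => k.
    have -> : row k (Gam *m P q *m H q) = nabla X (fun q => E k q *m H q) q.
      by rewrite (H_parallel o iq SX (SE k)) !row_mul rowK -expand.
    have SNE l := smooth_vfieldZ o (SN k l) (SE l).
    have e1 q' : dom i q' -> E k q' *m H q' = \sum_l N q' k l *: E l q'.
      move=> iq'; rewrite [LHS](frame_expansion _ iq').
      by apply: eq_bigr => l _; rewrite /N mxE.
    rewrite (nabla_congr_r hn o iq SX (H_smooth o (SE k)) e1).
    rewrite (nabla_sumr hn _ o iq SX SNE).
    rewrite mulmxDl linearD /= -mulmxA !row_mul !mulmx_sum_row -big_split /=.
    apply: eq_bigr => l _; rewrite rowK (connection_leibniz hn o (SN k l) SX (SE l) iq).
    have -> : row l (Gam *m P q) = nabla X (E l) q by rewrite row_mul rowK -expand.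
    by rewrite ![row k _ 0 l]mxE [N' k l]mxE.
  have dtE : vder A X t q = 2 * \tr (N q *m N').
    rewrite (vder_fct_sum _ X o _ iq); last first.
      by move=> k; apply: smooth_on_sum => // l; exact: smooth_onM.
    have -> : 2 * \tr (N q *m N') = \tr (N q *m N') + \tr (N' *m N q).
      by rewrite [in RHS](mxtrace_mulC N') mulrDl mul1r.
    rewrite -big_split /=; apply: eq_bigr => k _.
    rewrite (vder_fct_sum _ X o _ iq); last by move=> l; exact: smooth_onM.
    rewrite ![(_ *m _) k k]mxE -big_split /=; apply: eq_bigr => l _.
    rewrite (vder_fctM X o (SN k l) (SN l k) iq); congr (_ * _ + _).
      by rewrite [RHS]mxE.
    by rewrite mulrC; congr (_ * _); rewrite [RHS]mxE.
  by rewrite dtE N'E trace_mul_commutator mulr0.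
have near_t : \forall z \near x_ i p, (t \o chart_inv A i) z = (t \o chart_inv A i) (x_ i p).
  apply: (diff0_locally_constant (open_chart_image (i := i) o) (mem_chart_image ip_ ip_)).
    by move=> _ [q [iq _] <-]; exact: (smooth_on_diff St iq iq).
  move=> _ v [q [iq _] <-]; have d := smooth_on_diff St iq iq.
  rewrite (@deriveE _ _ _ _ _ _ d) diff_row_sum big1 // => k _.
  by rewrite -(@deriveE _ _ _ _ _ _ d) -(vder_coord_vfield k St iq iq) dt // scaler0.
have near_q := near_chart_map ip_ near_t.
apply: filterS2 near_q (open_nbhs_nbhs (conj o ip_)) => q /= + iq.
by rewrite !chart_mapK // !tE.
Qed.

(** [tr(H^2)] vanishes at a maximum of [|xi|^2] and is locally constant, so it
    vanishes on the connected manifold [M]; and [H] is self-adjoint. *)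
Lemma H_eq0 p : compact [set: M] -> connected [set: M] -> H p = 0.
Proof.
move=> cM kM.
have Sf : smooth_on A setT (inner g xi xi).
  by apply: (metric_smooth hg openT); exact: xi_smooth.
have [|m _ mmax] := @compact_EVT_max M R (inner g xi xi) setT (ex_intro _ p I) cM.
  by apply: continuous_subspaceT => q; exact: smooth_on_continuous openT Sf I.
have tm : \tr (H m *m H m) = 0.
  by apply: trace_H2_at_max => q; apply: mmax; rewrite inE.
have tp : \tr (H p *m H p) = 0.
  pose Z := [set q | \tr (H q *m H q) = 0].
  suff : Z = setT by move=> ZT; have : setT p by []; rewrite -ZT.
  apply: kM; first by exists m.
    exists Z; last by rewrite setTI.
    rewrite openE => q Zq; have := trace_H2_locally_constant q.
    by apply: filterS => q' /=; rewrite /Z /= => ->.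
  exists Z; last by rewrite setTI.
  rewrite -openC openE => q Zq; have := trace_H2_locally_constant q.
  by apply: filterS => q' /= e Zq'; apply: Zq; rewrite /Z /= -e.
apply: (self_adjoint_trace_sqr_eq0 (Defs.metric_sym hg p) _ _ tp).
  by move=> v; exact: metric_pos hg p v.
apply/matrixP => k l.
have := H_sym p (delta_mx 0 k) (delta_mx 0 l); rewrite /inner_at.
rewrite trmx_mul !mulmxA -[_ *m H p *m g p]mulmxA.
by rewrite -[_ *m g p *m (H p)^T]mulmxA !mx_entry.
Qed.

End AffineConformal.
End Soliton.

Theorem proposition4p6 (R : realType) (n : nat) (M : topologicalType)
    (A : smooth_manifold R n M) (g : M -> 'M[R]_n)
    (nabla : vfield R n M -> vfield R n M -> vfield R n M)
    (xi : vfield R n M) (lambda rho : M -> R) (H : M -> 'M[R]_n) :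
  (2 < n)%N ->
  compact [set: M] ->
  connected [set: M] ->
  riemannian_metric A g ->
  levi_civita A g nabla ->
  almost_ricci_soliton A g nabla xi lambda ->
  closed_vfield A g xi ->
  smooth A rho ->
  affine_conformal_killing A g nabla xi rho ->
  is_H_tensor A g xi rho H ->
  (forall p : M, \tr (H p) = 0) ->
  conformal_killing A g xi /\ einstein A g nabla.
Proof.
move=> n_gt2 cM kM hg hLC [hxi _ hR] hclosed hrho [G hG hL] hH htr.
have n_gt0 : (0 < n)%N by exact: ltn_trans n_gt2.
have H0 p : H p = 0.
  exact: (H_eq0 hg hLC hxi hclosed hrho hH hG hL n_gt0 htr hR p cM kM).
have ricE U X Y p : open U -> U p -> smooth_vfield_on A U X ->
    smooth_vfield_on A U Y ->
    ricci A nabla X Y p = (lambda p - rho p) * inner g X Y p.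
  move=> oU Up SX SY.
  rewrite (ricciE hg hLC hxi hclosed hH hR oU Up SX SY).
  by rewrite H0 mulmx0 ip0l mulr0 subr0.
split.
  exists rho => // U X Y oU SX SY p Up.
  have := hH U X Y oU SX SY p Up; rewrite innerE /= H0 mulmx0 ip0l.
  by move/esym/eqP; rewrite subr_eq0 => /eqP.
move=> U X Y oU SX SY p Up; rewrite (ricE U X Y p oU Up SX SY).
have gU : g p \in unitmx.
  rewrite -row_free_unit -kermx_eq0; apply/negPn/negP => /rowV0Pn[v].
  move=> /sub_kermxP vg v0; have := metric_pos hg p v0.
  by rewrite vg mul0mx mxE ltxx.
have -> : scalar_curvature A g nabla p = n%:R * (lambda p - rho p).
  rewrite /scalar_curvature.
  have -> : \matrix_(i < n, j < n)
      ricci A nabla (coord_vfield (chart_at A p) i)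
        (coord_vfield (chart_at A p) j) p = (lambda p - rho p) *: g p.
    apply/matrixP => i j; rewrite !mxE.
    have o := open_dom (A := A) (chart_at A p); have cp := chart_atP A p.
    rewrite (ricE _ _ _ p o cp (coord_vfield_smooth _ _) (coord_vfield_smooth _ _)).
    by rewrite innerE !coord_vfield_at /inner_at mx_entry.
  by rewrite -scalemxAr mxtraceZ mulVmx // mxtrace1 mulrC.
by rewrite [n%:R * _]mulrC mulfK // pnatr_eq0 -lt0n.
Qed.
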